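(* Let $0<c\le 1$. There exists $n_0(c)$ such that for all $n\ge n_0(c)$ and every family $\mathcal{E}\subset T_n(2)$ of $2$-simplices of $T_n$ with $|\mathcal{E}|\ge cn^3$, if $L$ is a uniformly random Latin square in $\mathcal{L}_n$, then $$\Pr\left[f_{\mathcal{E}}(L)<10^{-3}c^2n^2\right]<e^{-10^{-3}c^2n^2}.$$
   Context: Let $\mathbb{S}_n$ be the symmetric group on $[n]=\{1,\ldots,n\}$. A Latin square of order $n$ is an $n$-tuple $L=(\pi_1,\ldots,\pi_n)\in\mathbb{S}_n^n$ such that $\pi_i\pi_j^{-1}$ is fixed point free for all $1\le i<j\le n$. $\mathcal{L}_n$ denotes the set of all Latin squares of order $n$, with the uniform probability measure. Let $V_1=\{a_i\}_{i=1}^n$, $V_2=\{b_i\}_{i=1}^n$, $V_3=\{c_i\}_{i=1}^n$ be three disjoint sets. The complete 3-partite complex $T_n$ is the simplicial complex on $V_1\cup V_2\cup V_3$ consisting of all $\sigma$ with $|\sigma\cap V_i|\le 1$ for $i=1,2,3$; $T_n(2)$ is its set of 2-simplices (so $|T_n(2)|=n^3$). For $L=(\pi_1,\ldots,\pi_n)\in\mathcal{L}_n$, $Y(L)$ is the subcomplex of $T_n$ containing the full 1-skeleton of $T_n$ whose set of 2-simplices is $Y(L)(2)=\{[a_i,b_j,c_{\pi_i(j)}]:1\le i,j\le n\}$. For $\mathcal{E}\subset T_n(2)$ define $f_{\mathcal{E}}(L)=|Y(L)(2)\cap\mathcal{E}|$. *)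

(* Defs.v *)
From mathcomp Require Import all_boot all_order all_algebra all_fingroup.
From mathcomp Require Import reals.

Set Implicit Arguments.
Unset Strict Implicit.
Unset Printing Implicit Defensive.

Import Order.TTheory GRing.Theory Num.Theory.

Section LatinSquares.
Variable n : nat.

Definition fixed_point_free (s : 'S_n) : bool := [forall x, s x != x].

(* Products in 'S_n are read from left to right: (s * t) x = t (s x).  Hence
   the composite "first pi_j^-1, then pi_i" is written pi_j^-1 * pi_i. *)
Definition is_latin_square (L : n.-tuple 'S_n) : bool :=
  [forall i : 'I_n, forall j : 'I_n,
    (i < j)%N ==> fixed_point_free ((tnth L j)^-1 * tnth L i)%g].

Definition latin_squares : {set n.-tuple 'S_n} := [set L | is_latin_square L].

(* The vertex (k, i) is the i-th vertex of the k-th of the three parts; all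
   indices start at 0. *)
Definition vertex : finType := ('I_3 * 'I_n)%type.

Definition va (i : 'I_n) : vertex := (@Ordinal 3 0 isT, i).
Definition vb (i : 'I_n) : vertex := (@Ordinal 3 1 isT, i).
Definition vc (i : 'I_n) : vertex := (@Ordinal 3 2 isT, i).

Definition part (k : 'I_3) : {set vertex} := [set v | v.1 == k].

(* A simplicial complex is represented by its set of faces, the empty face
   included. *)
Definition tripartite_complex : {set {set vertex}} :=
  [set s : {set vertex} | [forall k, #|s :&: part k| <= 1]%N].

Definition simplices (d : nat) (X : {set {set vertex}}) : {set {set vertex}} :=
  [set s in X | #|s| == d.+1].

Definition skeleton (d : nat) (X : {set {set vertex}}) : {set {set vertex}} :=
  [set s in X | #|s| <= d.+1]%N.

Definition latin_complex (L : n.-tuple 'S_n) : {set {set vertex}} :=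
  skeleton 1 tripartite_complex
  :|: [set [set va i; vb j; vc (tnth L i j)] | i : 'I_n, j : 'I_n].

Definition hits (E : {set {set vertex}}) (L : n.-tuple 'S_n) : nat :=
  #|simplices 2 (latin_complex L) :&: E|.

End LatinSquares.

Definition uniform_pr (R : realType) (T : finType) (A : {set T}) (P : pred T) : R :=
  (#|[set x in A | P x]|%:R / #|A|%:R)%R.

(* Main.v *)
(** The triangles of E are penalised with the weight 2^-hits.

    Lower bound on the number of Latin squares: the permanent of a doubly
    stochastic matrix is at least e^-n (Gurvits' capacity argument: directional
    derivatives of a product of variables are stable, hence real-rooted on
    lines, and a polynomial p with negative roots satisfies
    p(t) <= p(0) exp(t p'(0) / p(0))).  Adding the rows one at a time gives at
    least (n / e^2)^(n^2) Latin squares.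

    Upper bound on the total weight: fill the cells in a given order, each with
    a still available symbol drawn proportionally to its weight.  Every Latin
    square appears with probability (its weight) / (product over the cells of
    the weight Z still available), so these ratios sum to at most 1.  Averaging
    over random orders of the rows and of the columns, ln Z is on average at
    most ln W_ij - 2 + o(1) by concavity, W_ij being the total weight of the
    symbols at the cell (i, j).  Since W_ij = n - d_ij / 2 and the d_ij sum to
    |E| >= c n^3, the total weight is at most
    (n / e^2)^(n^2) exp(- c n^2 / 2 + o(n^2)), and Markov's inequality for the
    weight concludes. *)

Require Import Defs.
From mathcomp Require Import all_boot all_order all_algebra all_fingroup.
From mathcomp Require Import complex polyrcf.
From mathcomp Require Import reals sequences exp.
From mathcomp Require Import ring lra zify.

Set Implicit Arguments.
Unset Strict Implicit.
Unset Printing Implicit Defensive.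

Import Order.TTheory GRing.Theory Num.Theory.
Local Open Scope ring_scope.

(** * Real-rooted polynomials *)

Section RealRooted.
Variable R : realType.
Implicit Types (z : R[i]) (t : R) (rs : seq R[i]).

Lemma ImD (x y : R[i]) : complex.Im (x + y) = complex.Im x + complex.Im y.
Proof. by case: x => a b; case: y => c d. Qed.

Lemma Im_inv_opp_lt0 z : complex.Im z < 0 -> complex.Im (- z)^-1 < 0.
Proof.
case: z => a b /= b_lt0; rewrite mulNr opprK.
have pos : 0 < (- a) ^+ 2 + (- b) ^+ 2.
  by apply: ltr_wpDl; [exact: sqr_ge0 | rewrite exprn_gt0 // oppr_gt0].
by rewrite pmulr_llt0 // invr_gt0.
Qed.

(* Gauss-Lucas: the logarithmic derivative at 0 is the sum of the - 1 / z over
   the roots z, each of which has a negative imaginary part. *)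
Lemma deriv0_neq0 (q : {poly R[i]}) :
  (forall s, 0 <= complex.Im s -> q.[s] != 0) -> (1 < size q)%N ->
  q^`().[0] != 0.
Proof.
move=> q_neq0 size_q; have [rs def_q] := closed_field_poly_normal q.
have lc_neq0 : lead_coef q != 0.
  by rewrite lead_coef_eq0 -size_poly_gt0 ltnW.
have rs_neg z : z \in rs -> complex.Im z < 0.
  move=> z_rs; rewrite ltNge; apply/negP => /q_neq0 /negP; apply.
  rewrite def_q hornerZ mulf_eq0 (negPf lc_neq0) /=.
  by rewrite -/(root _ _) root_prod_XsubC.
have rs_neq0 : rs != [::].
  apply/eqP => rs0; move: size_q; rewrite def_q rs0 big_nil.
  by rewrite size_scale // size_poly1.
rewrite def_q derivZ hornerZ mulf_neq0 //.
set P := \prod_(z <- rs) _.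
suff [P0 dP] : P.[0] != 0 /\ complex.Im (P^`().[0] / P.[0]) < 0.
  by apply: contraTneq dP => ->; rewrite mul0r /= ltxx.
rewrite {}/P; elim: rs rs_neg rs_neq0 {def_q} => // z rs IH rs_neg _.
have z_neg : complex.Im z < 0 by apply: rs_neg; rewrite mem_head.
have z_neq0 : - z != 0.
  by rewrite oppr_eq0; apply: contraTneq z_neg => ->; rewrite /= ltxx.
rewrite big_cons derivM !hornerE derivXsubC hornerE ?sub0r /=.
have [->|rs_neq0] := eqVneq rs [::].
  rewrite big_nil !hornerE derivC hornerE mulr0 addr0 mul1r; split=> //.
  exact: Im_inv_opp_lt0.
have [] := IH _ rs_neq0.
  by move=> y y_rs; apply: rs_neg; rewrite inE y_rs orbT.
move: (\prod_(j <- rs) _) => P P0 dP; split; first by rewrite mulf_neq0.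
have -> : (1 * P.[0] + - z * P^`().[0]) / (- z * P.[0])
          = (- z)^-1 + P^`().[0] / P.[0].
  rewrite mul1r mulrDl invfM mulrCA divff // mulr1; congr (_ + _).
  by rewrite mulrACA divff // mul1r.
by rewrite ImD ltr_wnDl // ltW // Im_inv_opp_lt0.
Qed.

(** Each factor satisfies t - x = - x (1 + t / - x) <= - x exp(t / - x), and logarithmic derivatives
    at 0 add up over the factors. *)
Lemma le_exp_prod (xs : seq R) (k : R) : 0 < k -> all (< 0) xs ->
  let p := k *: \prod_(x <- xs) ('X - x%:P) in
  0 < p.[0] /\
  forall t, 0 <= t -> 0 <= p.[t] <= p.[0] * expR (t * p^`().[0] / p.[0]).
Proof.
move=> k0 /=; elim: xs => [_|x xs IH /andP[x_neg xs_neg]].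
  rewrite big_nil !hornerE; split=> // t t0.
  rewrite derivZ derivC scaler0 !hornerE ?(mulr0, mul0r, expR0, mulr1).
  by rewrite lexx ltW.
have [p0 IHp] := IH xs_neg.
rewrite big_cons scalerAr; move: (k *: _) p0 IHp => p p0 IHp.
have x0 : 0 < - x by rewrite oppr_gt0.
rewrite hornerM !hornerE ?sub0r; split; first exact: mulr_gt0.
move=> t t0; rewrite hornerM !hornerE derivM derivXsubC !hornerE ?sub0r.
have /andP[pt0 pt] := IHp t t0.
have tx : 0 <= t - x by rewrite addr_ge0 // ltW.
rewrite mulr_ge0 //=.
have -> : t * (p.[0] + - x * p^`().[0]) / (- x * p.[0])
  = t / - x + t * p^`().[0] / p.[0] by field; rewrite gt_eqF // lt_eqF.
rewrite expRD mulrACA; apply: ler_pM => //.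
have -> : t - x = - x * (1 + t / - x) by field; rewrite lt_eqF.
by rewrite ler_pM2l // expR_ge1Dx.
Qed.

(** Real coefficients make the roots come in conjugate pairs, so a polynomial with no root in the
    upper half-plane has only real roots. Positivity on t >= 0 makes these negative and the leading
    coefficient positive. *)
Lemma real_rooted_le_exp (p : {poly R}) :
  (forall z, 0 < complex.Im z -> (map_poly (real_complex R) p).[z] != 0) ->
  (forall t, 0 <= t -> 0 < p.[t]) ->
  forall t, 0 <= t -> p.[t] <= p.[0] * expR (t * p^`().[0] / p.[0]).
Proof.
move=> p_neq0 p_pos t t0.
have [rs def_p] := closed_field_poly_normal (map_poly (real_complex R) p).
have p0 : p.[0] != 0 by rewrite gt_eqF // p_pos.
have p_nz : p != 0 by apply: contra_neq p0 => ->; rewrite horner0.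
have rs_real z : z \in rs -> z = (complex.Re z)%:C%C.
  move=> z_rs.
  have z_root : (map_poly (real_complex R) p).[z] = 0.
    apply/eqP; rewrite def_p hornerZ mulf_eq0 -/(root _ z).
    by rewrite root_prod_XsubC z_rs orbT.
  have conj_root : (map_poly (real_complex R) p).[conjc z] = 0.
    have <- : map_poly (@conjc R) (map_poly (real_complex R) p)
              = map_poly (real_complex R) p.
      rewrite -map_poly_comp; apply: eq_map_poly => x /=.
      by rewrite oppr0.
    by rewrite horner_map z_root rmorph0.
  case: z z_rs z_root conj_root => a b /= _ z_root conj_root.
  congr Complex; apply/eqP; case: ltrgtP => // b0.
    by have := p_neq0 (Complex a (- b)); rewrite /= oppr_gt0 b0 conj_root eqxx
      => /(_ isT).
  by have := p_neq0 (Complex a b); rewrite /= b0 z_root eqxx => /(_ isT).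
have {rs_real} def_rs : rs = map (real_complex R) (map (@complex.Re R) rs).
  by rewrite -map_comp map_id_in // => z /rs_real.
move: def_p; rewrite def_rs big_map lead_coef_map.
move: (map _ rs) => xs {rs def_rs} def_p.
have {}def_p : p = lead_coef p *: \prod_(x <- xs) ('X - x%:P).
  apply: (map_poly_inj (real_complex R)).
  rewrite def_p map_polyZ rmorph_prod /=; congr (_ *: _).
  by apply: eq_bigr => x _; rewrite rmorphB /= map_polyX map_polyC.
have xs_neg : all (< 0) xs.
  apply/allP => x x_xs; rewrite /= ltNge; apply/negP => /p_pos.
  rewrite def_p hornerZ (rootP _) ?mulr0 ?ltxx //.
  by rewrite root_prod_XsubC.
have lc_pos : 0 < lead_coef p.
  have := p_pos 0 (lexx 0); rewrite def_p hornerZ lead_coefZ.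
  rewrite lead_coef_prod_XsubC mulr1 horner_prod pmulr_lgt0 //.
  rewrite big_seq prodr_gt0 // => x x_xs; rewrite !hornerE ?sub0r oppr_gt0.
  by move/allP: xs_neg => /(_ x x_xs).
have [_ /(_ t t0)/andP[_]] := le_exp_prod lc_pos xs_neg.
by rewrite -def_p.
Qed.

End RealRooted.

(** * Stability of multiaffine polynomials *)

(* A multiaffine polynomial in variables indexed by 'I_n is represented by its
   coefficient function: F S is the coefficient of the product of the z r for
   r in S. *)
Section Multiaffine.
Variables (K : idomainType) (n : nat).
Implicit Types (F : {set 'I_n} -> K) (a z : 'I_n -> K) (S : {set 'I_n}).

Definition meval F z : K := \sum_S F S * \prod_(r in S) z r.

(** These are the coefficients of the sum of the a r d/dz_r: the derivative in z r removes r from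
    every monomial that contains it. *)
Definition dirderiv a F S : K := \sum_(r | r \notin S) a r * F (r |: S).

Definition mline F z a : {poly K} :=
  \sum_S F S *: \prod_(r in S) ((z r)%:P + a r *: 'X).

Lemma horner_mline F z a s :
  (mline F z a).[s] = meval F (fun r => z r + a r * s).
Proof.
rewrite horner_sum; apply: eq_bigr => S _; rewrite hornerZ horner_prod.
by congr (_ * _); apply: eq_bigr => r _; rewrite !hornerE.
Qed.

Lemma deriv_prod_line (I : finType) (P : {set I}) (u v : I -> K) :
  (\prod_(r in P) ((u r)%:P + v r *: 'X))^`().[0]
  = \sum_(r in P) v r * \prod_(q in P :\ r) u q.
Proof.
elim: {P}_.+1 {-2}P (ltnSn #|P|) => // m IH P ltPm.
have [->|[r0 r0P]] := set_0Vmem P; first by rewrite !big_set0 derivC horner0.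
rewrite (big_setD1 r0) //= derivM hornerD !hornerM IH; last first.
  by move: ltPm; rewrite (cardsD1 r0 P) r0P.
rewrite derivD derivC derivZ derivX !hornerE ?(mulr1, add0r, mulr0, addr0).
rewrite (big_setD1 r0 r0P) /=; congr (_ + _).
  rewrite horner_prod; congr (_ * _); apply: eq_bigr => r _.
  by rewrite !hornerE ?mulr0 ?addr0.
rewrite big_distrr /=; apply: eq_bigr => r; rewrite !inE => /andP[r_r0 rP].
rewrite mulrCA (big_setD1 (A := P :\ r) r0) /=; last first.
  by rewrite !inE r0P eq_sym r_r0.
congr (_ * (_ * _)); apply: eq_bigl => q; rewrite !inE.
by rewrite andbCA.
Qed.

Lemma deriv_mline F z a : (mline F z a)^`().[0] = meval (dirderiv a F) z.
Proof.
rewrite /mline raddf_sum horner_sum /=.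
transitivity (\sum_(S : {set 'I_n}) \sum_(r in S)
                F S * (a r * \prod_(q in S :\ r) z q)).
  by apply: eq_bigr => S _; rewrite derivZ hornerZ deriv_prod_line big_distrr.
rewrite (exchange_big_dep xpredT) //=.
transitivity (\sum_r \sum_(S : {set 'I_n} | r \notin S)
                 a r * F (r |: S) * \prod_(q in S) z q).
  apply: eq_bigr => r _.
  (* Removing r matches the sets that contain r with those that avoid it. *)
  rewrite (reindex_onto (fun S => r |: S) (fun S => S :\ r)) /=; last first.
    by move=> S rS; rewrite setD1K.
  apply: eq_big => [S|S /andP[_ /eqP->]]; last by ring.
  rewrite setU11 /=; apply/eqP/idP => [<-|rS]; first by rewrite setD11.
  by rewrite setU1K.
rewrite (exchange_big_dep xpredT) //=; apply: eq_bigr => S _.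
by rewrite mulr_suml.
Qed.

Lemma coef_prod_line (I : finType) (P : {set I}) (u v : I -> K) :
  (forall r, v r != 0) ->
  (\prod_(r in P) ((u r)%:P + v r *: 'X))`_(#|P|) = \prod_(r in P) v r.
Proof.
move=> v_neq0.
have size_line r : size ((u r)%:P + v r *: 'X) = 2.
  rewrite addrC size_addl ?size_scale ?size_polyX //.
  by rewrite ltnS size_polyC leq_b1.
have line_neq0 r : (u r)%:P + v r *: 'X != 0.
  by rewrite -size_poly_gt0 size_line.
transitivity (lead_coef (\prod_(r in P) ((u r)%:P + v r *: 'X))).
  rewrite lead_coefE size_prod // (eq_bigr (fun=> 2)%N) // sum_nat_const.
  by rewrite muln2 -addnn subSn ?leq_addr // addKn.
rewrite lead_coef_prod; apply: eq_bigr => r _.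
by rewrite lead_coefE size_line /= coefD coefC coefZ coefX mulr1 add0r.
Qed.

End Multiaffine.

Section Stability.
Variables (R : realType) (n : nat).
Implicit Types (F : {set 'I_n} -> R) (a : 'I_n -> R) (S : {set 'I_n}).

Definition stable F :=
  forall z : 'I_n -> R[i], (forall r, 0 < complex.Im (z r)) ->
  meval (fun S => (F S)%:C%C) z != 0.

(** Homogeneity of degree d, with every multiaffine monomial of that degree present. Strict
    positivity fixes the degree of the restriction to any line with positive direction. *)
Definition positive_form (d : nat) F : Prop :=
  forall S, if #|S| == d then (0 < F S : Prop) else F S = 0.

Lemma positive_form_ge0 d F S : positive_form d F -> 0 <= F S.
Proof. by move/(_ S); case: eqP => [_ /ltW|_ ->]. Qed.

Lemma exists_set_card d : (d <= n)%N -> exists S, #|S| = d.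
Proof.
move=> d_le_n; exists [set i in take d (enum 'I_n)].
rewrite cardsE; have /card_uniqP -> := take_uniq d (enum_uniq 'I_n).
by rewrite size_takel // -cardE card_ord.
Qed.

Lemma meval_gt0 d F a : (d <= n)%N -> positive_form d F -> (forall r, 0 < a r) ->
  0 < meval F a.
Proof.
move=> d_le_n F_pos a0; have [S0 cardS0] := exists_set_card d_le_n.
rewrite /meval (bigD1 S0) //= ltr_pwDl //.
  apply: mulr_gt0; last exact: prodr_gt0.
  by have := F_pos S0; rewrite cardS0 eqxx.
apply: sumr_ge0 => S _; rewrite mulr_ge0 ?(positive_form_ge0 _ F_pos) //.
by apply: prodr_ge0 => r _; rewrite ltW.
Qed.

Lemma positive_form_dirderiv d F a : (d < n)%N -> (forall r, 0 < a r) ->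
  positive_form d.+1 F -> positive_form d (dirderiv a F).
Proof.
move=> d_lt_n a0 F_pos S; case: ifP => [/eqP cardS|/eqP cardS].
  have [r rS] : exists r, r \notin S.
    apply/existsP; rewrite -negb_forall; apply/negP => /forallP allS.
    move: d_lt_n; rewrite -cardS (_ : S = setT) ?cardsT ?card_ord ?ltnn //.
    by apply/setP => x; rewrite allS inE.
  rewrite /dirderiv (bigD1 r) //= ltr_pwDl //.
    apply: mulr_gt0 => //; have := F_pos (r |: S).
    by rewrite cardsU1 rS cardS eqxx.
  by apply: sumr_ge0 => q _; rewrite mulr_ge0 ?(positive_form_ge0 _ F_pos) ?ltW.
apply: big1 => r rS; have := F_pos (r |: S).
rewrite cardsU1 rS add1n eqSS; case: eqP => // _ ->.
by rewrite mulr0.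
Qed.

(** On the line z + s a with Im s >= 0 every coordinate stays in the open upper half-plane, so the
    restriction of F has no root there, and [deriv0_neq0] applies to it. *)
Lemma stable_dirderiv d F a : (d < n)%N -> (forall r, 0 < a r) ->
  positive_form d.+1 F -> stable F -> stable (dirderiv a F).
Proof.
move=> d_lt_n a0 F_pos F_stable z z_pos.
have -> : meval (fun S => (dirderiv a F S)%:C%C) z
  = (mline (fun S => (F S)%:C%C) z (fun r => (a r)%:C%C))^`().[0].
  rewrite deriv_mline; apply: eq_bigr => S _; congr (_ * _).
  by rewrite rmorph_sum; apply: eq_bigr => r _; rewrite rmorphM.
apply: deriv0_neq0 => [s s0|].
  rewrite horner_mline F_stable // => r; rewrite ImD.
  by case: s s0 => s1 s2 /= s0; rewrite mul0r addr0 ltr_wpDr // mulr_ge0 // ltW.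
(* The restriction is not constant: its coefficient of degree d + 1 is the value of F at a, which is
   positive. *)
rewrite ltnNge; apply/negP => /leq_sizeP/(_ d.+1 isT)/eqP; apply/negP.
have -> : (mline (fun S => (F S)%:C%C) z (fun r => (a r)%:C%C))`_d.+1
  = (\sum_(S : {set 'I_n} | #|S| == d.+1) F S * \prod_(r in S) a r)%:C%C.
  rewrite coef_sum rmorph_sum [RHS]big_mkcond; apply: eq_bigr => S _ /=.
  rewrite coefZ; have := F_pos S; case: eqP => [cardS _|_ ->]; last first.
    by rewrite mul0r.
  rewrite -cardS coef_prod_line ?rmorphM ?rmorph_prod // => r.
  by rewrite eq_complex /= eqxx andbT gt_eqF.
rewrite eq_complex /= eqxx andbT gt_eqF //.
have [S0 cardS0] := exists_set_card d_lt_n.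
rewrite (bigD1 S0) ?cardS0 //= ltr_pwDl //.
  apply: mulr_gt0; last exact: prodr_gt0.
  by have := F_pos S0; rewrite cardS0 eqxx.
apply: sumr_ge0 => S _; rewrite mulr_ge0 ?(positive_form_ge0 _ F_pos) //.
by apply: prodr_ge0 => r _; rewrite ltW.
Qed.

(** For Im s > 0 each b r + a r s has imaginary part a r Im s > 0, so stability excludes non-real
    roots on this line. *)
Lemma mline_le_exp d F (b a : 'I_n -> R) t :
  (d <= n)%N -> stable F -> positive_form d F ->
  (forall r, 0 < b r) -> (forall r, 0 < a r) -> 0 <= t ->
  meval F (fun r => b r + a r * t)
  <= meval F b * expR (t * meval (dirderiv a F) b / meval F b).
Proof.
move=> d_le_n F_stable F_pos b0 a0 t0.
have eval0 : (mline F b a).[0] = meval F b.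
  rewrite horner_mline; apply: eq_bigr => S _; congr (_ * _).
  by apply: eq_bigr => r _; rewrite mulr0 addr0.
rewrite -horner_mline -deriv_mline -eval0.
apply: real_rooted_le_exp t0 => [z z0|s s0].
  have -> : map_poly (real_complex R) (mline F b a)
    = mline (fun S => (F S)%:C%C) (fun r => (b r)%:C%C) (fun r => (a r)%:C%C).
    rewrite rmorph_sum; apply: eq_bigr => S _ /=.
    rewrite map_polyZ rmorph_prod /=; congr (_ *: _); apply: eq_bigr => r _.
    by rewrite rmorphD /= map_polyC map_polyZ map_polyX.
  rewrite horner_mline F_stable // => r.
  by rewrite ImD; case: z z0 => z1 z2 /= z0; rewrite mul0r add0r addr0 mulr_gt0.
rewrite horner_mline; apply: (meval_gt0 d_le_n F_pos) => r.
by rewrite ltr_pwDl // mulr_ge0 // ltW.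
Qed.

End Stability.

Lemma big_tuple_cons (R : nmodType) (T : finType) m (P : pred (seq T))
    (G : seq T -> R) :
  \sum_(t : m.+1.-tuple T | P t) G t
  = \sum_x \sum_(t : m.-tuple T | P (x :: t)) G (x :: t).
Proof.
rewrite pair_big_dep /=.
rewrite (reindex (fun p : T * m.-tuple T => cons_tuple p.1 p.2)) //.
exists (fun t => (thead t, behead_tuple t)) => [[x t] _|t _] /=.
  by rewrite theadE; congr pair; apply: val_inj.
by rewrite [RHS]tuple_eta.
Qed.

(** * Permanents as mixed directional derivatives of the product of the variables *)

Section MixedDerivative.
Variables (R : realType) (n : nat).
Implicit Types (l : seq ('I_n -> R)) (S : {set 'I_n}).

Definition monomial_form S : R := (S == setT)%:R.

Definition mixed l : {set 'I_n} -> R :=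
  foldr (@dirderiv R n) monomial_form l.

Lemma meval_monomial_form (z : 'I_n -> R) : meval monomial_form z = \prod_r z r.
Proof.
rewrite /meval (bigD1 setT) //= [X in _ + X]big1 => [|S /negPf S_neqT].
  by rewrite /monomial_form eqxx mul1r addr0; apply: eq_bigl => r; rewrite inE.
by rewrite /monomial_form S_neqT mul0r.
Qed.

Lemma stable_mixed l : (size l <= n)%N ->
  all (fun a : 'I_n -> R => [forall r, 0 < a r]) l ->
  positive_form (n - size l)%N (mixed l) /\ stable (mixed l).
Proof.
elim: l => [_ _|a l IH /= size_l /andP[/forallP a_pos l_pos]].
  rewrite subn0; split=> [S|z z_pos].
    rewrite /= /monomial_form; case: eqP => [cardS|cardS].
      rewrite (_ : S = setT) ?eqxx ?ltr01 //; apply/eqP.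
      by rewrite eqEcard subsetT cardsT card_ord cardS leqnn.
    by case: eqP => // S_T; case: cardS; rewrite S_T cardsT card_ord.
  rewrite /meval (bigD1 setT) //= [X in _ + X]big1 => [|S /negPf S_neqT].
    rewrite /monomial_form eqxx mul1r addr0; apply/prodf_neq0 => r _.
    by apply: contraTneq (z_pos r) => ->; rewrite /= ltxx.
  by rewrite /monomial_form S_neqT mul0r.
have [l_form l_stable] := IH (ltnW size_l) l_pos.
have lt_n : (n - (size l).+1 < n)%N by lia.
have def_d : (n - size l = (n - (size l).+1).+1)%N by lia.
rewrite def_d in l_form; split; first exact: positive_form_dirderiv.
exact: stable_dirderiv l_form l_stable.
Qed.

(** Each derivative removes one variable. A term of the coefficient at S records which variable each
    derivative removes: an injective tuple whose image is the complement of S. *)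
Lemma mixedE m l S : size l = m ->
  mixed l S = \sum_(t : m.-tuple 'I_n | uniq t && ([set x in t] == ~: S))
                \prod_(p <- zip l t) p.1 p.2.
Proof.
elim: l m S => [|a l IH] [|m] S //= => [_|[size_l]].
  rewrite big_mkcond (big_pred1 [tuple]) /= => [|t]; last first.
    by apply/esym/eqP; exact: tuple0.
  rewrite big_nil (_ : [set x in [::]] = set0); last first.
    by apply/setP => x; rewrite !inE.
  have -> : (set0 == ~: S) = (S == setT).
    by rewrite -setCT (inj_eq (@setC_inj _)) eq_sym.
  by rewrite /monomial_form; case: eqP.
rewrite (big_tuple_cons m (fun s => uniq s && ([set x in s] == ~: S))
           (fun s => \prod_(p <- zip (a :: l) s) p.1 p.2)) /=.
rewrite /dirderiv [LHS]big_mkcond; apply: eq_bigr => r _ /=.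
case: ifP => rS; last first.
  rewrite big1 // => t /andP[_ /eqP/setP/(_ r)].
  by rewrite !inE eqxx rS.
rewrite (IH m) // big_distrr /=; apply: eq_big => [t|t _]; last by rewrite big_cons.
rewrite -andbA andbCA; congr (_ && _); rewrite set_cons.
apply/eqP/andP => [def_t|[r_t /eqP def_t]].
  split; last by rewrite def_t setCU setIC -setDE setD1K // inE.
  by move/setP: def_t => /(_ r); rewrite !inE eqxx => ->.
apply/setP => x; move/setP: def_t => /(_ x); rewrite !inE.
by case: eqP => //= ->; rewrite (negPf r_t).
Qed.

(** After n derivatives only the constant term is left, and injective n-tuples are permutations, so
    the constant is a permanent. *)
Lemma mixed_set0 (c : nat -> 'I_n -> R) :
  mixed [seq c k | k <- iota 0 n] set0 = \sum_(s : 'S_n) \prod_(j < n) c j (s j).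
Proof.
rewrite (@mixedE n) ?size_map ?size_iota //.
transitivity (\sum_(t : n.-tuple 'I_n | uniq t) \prod_(j < n) c j (tnth t j)).
  apply: eq_big => [t|t _].
    case: (boolP (uniq t)) => //= t_uniq; rewrite setC0 eqEcard subsetT cardsT.
    have -> : #|[set x in val t]| = n.
      by rewrite cardsE -[RHS](size_tuple t); exact/card_uniqP.
    by rewrite card_ord leqnn.
  have -> : zip [seq c k | k <- iota 0 n] t
    = [seq (c j, tnth t j) | j : 'I_n <- enum 'I_n].
    by rewrite -val_enum_ord -map_comp -[in LHS](map_tnth_enum t) zip_map.
  by rewrite big_map big_enum.
pose h (s : 'S_n) := [tuple s i | i < n].
have h_inj : injective h.
  move=> s1 s2 /(congr1 (fun t => tnth t)) h12; apply/permP => i.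
  by rewrite -[LHS](tnth_mktuple s1) -[RHS](tnth_mktuple s2) -/(h s1) h12.
transitivity (\sum_(t in h @: setT) \prod_(j < n) c j (tnth t j)).
  apply: eq_bigl => t; apply/idP/imsetP => [/tuple_uniqP t_inj|[s _ ->]].
    exists (perm t_inj); rewrite ?inE //; apply: eq_from_tnth => i.
    by rewrite tnth_mktuple permE.
  by rewrite map_inj_uniq ?enum_uniq //; exact: perm_inj.
rewrite big_imset => [|s1 s2 _ _ /h_inj //]; apply: eq_big => s.
  by rewrite inE.
by move=> _; apply: eq_bigr => j _; rewrite tnth_mktuple.
Qed.

End MixedDerivative.

(** * A lower bound for permanents *)

Section PermanentLowerBound.
Variable R : realType.

Lemma ln_le_subr1 (x : R) : 0 < x -> ln x <= x - 1.
Proof.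
by move=> x0; have := expR_ge1Dx (ln x); rewrite lnK ?posrE //; lra.
Qed.

(** Concavity of ln, obtained by applying ln u <= u - 1 to the ratios u = x i / m with the mean
    m. *)
Lemma weighted_AMGM (I : finType) (p x : I -> R) :
  (forall i, 0 < p i) -> (forall i, 0 < x i) -> \sum_i p i = 1 ->
  expR (\sum_i p i * ln (x i)) <= \sum_i p i * x i.
Proof.
move=> p0 x0 p1; set m := \sum_i p i * x i.
have [i0 _|I0] := pickP I; last first.
  by move/eqP: p1; rewrite big_pred0 // eq_sym oner_eq0.
have m0 : 0 < m.
  rewrite /m (bigD1 i0) //= ltr_pwDl ?mulr_gt0 // sumr_ge0 // => i _.
  by rewrite mulr_ge0 ?ltW.
rewrite -[leRHS]lnK ?posrE // ler_expR -subr_le0.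
have -> : \sum_i p i * ln (x i) - ln m = \sum_i p i * ln (x i / m).
  rewrite -[ln m]mul1r -p1 mulr_suml -sumrB; apply: eq_bigr => i _.
  by rewrite -mulrBr ln_div ?posrE.
rewrite [leRHS](_ : _ = \sum_i p i * (x i / m - 1)); last first.
  rewrite (eq_bigr (fun i => p i * x i / m - p i)) => [|i _]; last by ring.
  by rewrite sumrB p1 -mulr_suml -/m divff ?subrr // gt_eqF.
apply: ler_sum => i _; rewrite ler_pM2l //.
by rewrite ln_le_subr1 ?divr_gt0.
Qed.

Variables (n : nat) (c : nat -> 'I_n -> R).
Hypotheses (c_gt0 : forall j r, 0 < c j r).
Hypotheses (row_sum : forall r, \sum_(j < n) c j r = 1).
Hypotheses (col_sum : forall j, (j < n)%N -> \sum_r c j r = 1).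

(** Differentiating along c k, ..., c (n - 1) leaves a form of degree k: degree n is the full
    product, degree 0 the permanent. *)
Let form k := mixed [seq c j | j <- iota k (n - k)].

Lemma form_step k : (k < n)%N -> form k = dirderiv (c k) (form k.+1).
Proof. by move=> k_lt_n; rewrite /form -[(n - k)%N]prednK ?subn_gt0 //= subnS. Qed.

Lemma form_stable k : (k <= n)%N -> positive_form k (form k) /\ stable (form k).
Proof.
move=> k_le_n; have := @stable_mixed R n [seq c j | j <- iota k (n - k)].
rewrite size_map size_iota subKn //; apply; first exact: leq_subr.
by rewrite all_map; apply/allP => j _ /=; apply/forallP.
Qed.

(* Along the line through b in direction c k, form k.+1 is a real-rooted p with
   p(t) <= p(0) exp(t p'(0) / p(0)); choosing t = p(0) / p'(0) loses a factor e,
   and p'(0) is the value of form k at b. *)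
Lemma meval_form_ge k (x : nat -> R) : (0 < k <= n)%N -> (forall j, 0 < x j) ->
  expR (- (n - k)%:R) * \prod_(j < k) x j
  <= meval (form k) (fun r => \sum_(j < k) c j r * x j).
Proof.
move=> /andP[k0 k_le_n]; rewrite -(subKn k_le_n).
have : (n - k < n)%N by lia.
elim: (n - k)%N x => [|m IH] x lt_mn x0.
  rewrite !subn0 subnn oppr0 expR0 mul1r /form subnn meval_monomial_form.
  (* AM-GM is applied at each r with the weights c j r, whose sum over j is 1. In the product over r
     the exponent of each x j is a column sum, again 1. *)
  apply: (@le_trans _ _ (\prod_r expR (\sum_(j < n) c j r * ln (x j)))).
    rewrite -expR_sum exchange_big /=.
    rewrite [X in expR X](eq_bigr (fun j : 'I_n => ln (x j))) => [|j _]; last first.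
      by rewrite -mulr_suml col_sum // mul1r.
    rewrite expR_sum; apply: ler_prod => j _.
    by rewrite lnK ?posrE // ltW //= lexx.
  apply: ler_prod => r _; rewrite expR_ge0 /=.
  exact: weighted_AMGM.
set k' := (n - m.+1)%N.
have def_k : (n - m = k'.+1)%N by rewrite /k'; lia.
have [k'0 k'n] : (0 < k')%N /\ (k' < n)%N by rewrite /k'; lia.
have [F_pos F_stable] := form_stable k'n.
pose b r := \sum_(j < k') c j r * x j.
have b0 r : 0 < b r.
  rewrite /b (bigD1 (Ordinal k'0)) //= ltr_pwDl ?mulr_gt0 // sumr_ge0 // => j _.
  by rewrite mulr_ge0 ?ltW.
rewrite form_step //; set q := meval (form k'.+1) b.
have q0 : 0 < q by exact: meval_gt0 F_pos _.
set q' := meval _ _.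
have q'0 : 0 < q'.
  rewrite /q' -form_step //; have [F'_pos _] := form_stable (ltnW k'n).
  exact: meval_gt0 (ltnW k'n) F'_pos _.
pose t := q / q'; have t0 : 0 < t by rewrite divr_gt0.
(* Giving the extra variable the value t moves the evaluation point of the induction hypothesis from
   b to b + t c k'. *)
pose y j := if j == k' then t else x j.
have y_pos j : 0 < y j by rewrite /y; case: ifP.
have y_x j : (j < k')%N -> y j = x j by rewrite /y => /ltn_eqF->.
have := IH y (ltnW lt_mn) y_pos; rewrite def_k big_ord_recr /= {2}/y eqxx.
rewrite (eq_bigr (fun j : 'I_k' => x j)) => [|j _]; last exact: y_x.
have -> : meval (form k'.+1) (fun r => \sum_(j < k'.+1) c j r * y j)
  = meval (form k'.+1) (fun r => b r + c k' r * t).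
  apply: eq_bigr => S _; congr (_ * _); apply: eq_bigr => r _.
  rewrite big_ord_recr /= {2}/y eqxx; congr (_ + _).
  by apply: eq_bigr => j _; rewrite y_x.
move=> /le_trans/(_ (mline_le_exp k'n F_stable F_pos b0 _ (ltW t0)))-/(_ (c_gt0 k')).
rewrite -/q -/q' (_ : t * q' / q = 1); last by rewrite /t; field; rewrite !gt_eqF.
have -> : (n - k' = (n - k'.+1).+1)%N by lia.
move: (\prod_(j < k') x j) => X.
rewrite -natr1 opprD expRD -def_k => le_qe.
have q_qt : q = q' * t by rewrite /t; field; rewrite gt_eqF.
have := ler_wpM2r (expR_ge0 (- 1)) le_qe.
rewrite -(mulrA q) expRxMexpNx_1 mulr1 q_qt => le_q't.
rewrite -(ler_pM2r t0); apply: le_trans le_q't.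
by rewrite le_eqVlt; apply/orP; left; apply/eqP; ring.
Qed.

(** [form 1] is linear, so its value at c 0 is its derivative along c 0, which is the permanent. *)
Lemma permanent_ge_pos : (0 < n)%N ->
  expR (- n%:R) <= \sum_(s : 'S_n) \prod_(j < n) c j (s j).
Proof.
move=> n_gt0; have [form1 _] := form_stable n_gt0.
have := @meval_form_ge 1 (fun=> 1) n_gt0 (fun=> ltr01).
have -> : meval (form 1) (fun r => \sum_(j < 1) c j r * 1)
          = \sum_(s : 'S_n) \prod_(j < n) c j (s j).
  rewrite -mixed_set0 [RHS](_ : _ = form 0 set0); last by rewrite /form subn0.
  rewrite (@form_step 0) // /dirderiv; move: (form 1) form1 => F form1.
  transitivity (\sum_S F S * \sum_(r | S == [set r]) c 0%N r).
    apply: eq_bigr => S _; have := form1 S.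
    case: cards1P => [[x ->] _|_ ->]; last by rewrite !mul0r.
    rewrite big_set1 big_ord1 mulr1 (big_pred1 x) // => r.
    by rewrite (inj_eq set1_inj) eq_sym.
  under eq_bigr => S _ do rewrite big_distrr.
  rewrite (exchange_big_dep xpredT) //=; apply: eq_big => [r|r _].
    by rewrite inE.
  by rewrite big_pred1_eq setU0 mulrC.
rewrite big1 // mulr1; apply: le_trans.
by rewrite ler_expR lerN2 ler_nat leq_subr.
Qed.

End PermanentLowerBound.

(* Zero entries are handled by letting e tend to 0 in (1 - e) A + e / n. *)
Lemma permanent_ge (R : realType) m (A : 'I_m.+1 -> 'I_m.+1 -> R) :
  (forall j r, 0 <= A j r) -> (forall j, \sum_r A j r = 1) ->
  (forall r, \sum_j A j r = 1) ->
  expR (- m.+1%:R) <= \sum_(s : 'S_m.+1) \prod_j A j (s j).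
Proof.
move=> A0 col_sum row_sum; set n := m.+1; set per := \sum_s _.
pose p : {poly R} :=
  \sum_(s : 'S_n) \prod_j ((A j (s j))%:P + (n%:R^-1 - A j (s j)) *: 'X).
have n0 : 0 < n%:R :> R by rewrite ltr0n.
have p_eval e : p.[e] = \sum_(s : 'S_n)
    \prod_j ((1 - e) * A j (s j) + e * n%:R^-1).
  rewrite horner_sum; apply: eq_bigr => s _; rewrite horner_prod.
  by apply: eq_bigr => j _; rewrite !hornerE; ring.
have p0 : p.[0] = per.
  rewrite p_eval; apply: eq_bigr => s _; apply: eq_bigr => j _.
  by rewrite subr0 mul1r mul0r addr0.
have p_ge e : 0 < e < 1 -> expR (- n%:R) <= p.[e].
  move=> /andP[e0 e1]; rewrite p_eval.
  pose c j r := (1 - e) * A (inord j) r + e * n%:R^-1.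
  rewrite (eq_bigr (fun s : 'S_n => \prod_(j < n) c j (s j))) => [|s _]; last first.
    by apply: eq_bigr => j _; rewrite /c inord_val.
  have sum_uniform : \sum_(j < n) n%:R^-1 = 1 :> R.
    by rewrite sumr_const card_ord -[_ *+ _]mulr_natl divff // gt_eqF.
  apply: permanent_ge_pos => // [j r|r|j _].
  - by rewrite ltr_wpDl ?mulr_gt0 ?invr_gt0 // mulr_ge0 // subr_ge0 ltW.
  - rewrite big_split -!mulr_sumr /= sum_uniform.
    under eq_bigr => j _ do rewrite inord_val.
    by rewrite row_sum; ring.
  - by rewrite big_split -!mulr_sumr /= sum_uniform col_sum; ring.
rewrite -p0 leNgt; apply/negP => p_lt.
have [d d0 p_cont] := @poly_cont R 0 p _ (etrans (subr_gt0 _ _) p_lt).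
pose e := Num.min (d / 2) (1 / 2).
have e0 : 0 < e by rewrite lt_min !divr_gt0.
have e1 : e < 1 by rewrite gt_min; apply/orP; right; lra.
have e_d : `|e - 0| < d.
  by rewrite subr0 gtr0_norm // gt_min; apply/orP; left; lra.
have := p_cont e e_d; have := p_ge e; rewrite e0 e1 => /(_ isT) pe.
by rewrite ltNge; apply/negP; rewrite negbK ler_normr lerD2r pe.
Qed.

(** * Counting Latin squares from below *)

Definition discordant n (s t : 'S_n) : bool := [forall x, s x != t x].

Lemma is_latin_squareE n (L : n.-tuple 'S_n) :
  is_latin_square L = pairwise (@discordant n) L.
Proof.
have fpfE (s t : 'S_n) : fixed_point_free (t^-1 * s)%g = discordant s t.
  apply/forallP/forallP => st x; last by have := st (t^-1 x)%g; rewrite permM permKV.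
  by have := st (t x); rewrite permM permK.
apply/forallP/(pairwiseP 1%g) => L_lat.
  move=> i j; rewrite !inE size_tuple => i_n j_n ij.
  have /forallP/(_ (Ordinal j_n))/implyP/(_ ij) := L_lat (Ordinal i_n).
  by rewrite fpfE !(tnth_nth 1%g).
move=> i; apply/forallP => j; apply/implyP => ij.
by rewrite fpfE !(tnth_nth 1%g) L_lat ?inE ?size_tuple.
Qed.

Lemma card_notin (T : finType) (u : seq T) :
  uniq u -> #|[pred x | x \notin u]| = (#|T| - size u)%N.
Proof. by move=> /card_uniqP <-; rewrite -(cardC (mem u)) addKn; apply: eq_card. Qed.

Section LatinCount.
Variables (R : realType) (m : nat).
Let n := m.+1.
Implicit Types (t : seq 'S_n).

(** Put 1 / k at the symbols still free in each column. Each column has k free symbols and each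
    symbol is free in k columns, so this matrix is doubly stochastic; its permanent is k^-n times
    the number of possible next rows. *)
Lemma card_discordant_ge t : (size t < n)%N -> pairwise (@discordant n) t ->
  (n - size t)%:R ^+ n * expR (- n%:R)
  <= #|[pred s | all (discordant s) t]|%:R :> R.
Proof.
move=> size_t t_disc; set k := (n - size t)%N.
have k0 : 0 < k%:R :> R by rewrite ltr0n subn_gt0.
pose A (j s : 'I_n) : R := if s \in [seq q j | q : 'S_n <- t] then 0 else k%:R^-1.
have A_sum (u : seq 'I_n) : uniq u -> size u = size t ->
    \sum_s (if s \in u then 0 else k%:R^-1) = 1 :> R.
  move=> u_uniq size_u; transitivity (\sum_(s | s \notin u) k%:R^-1 : R).
    by rewrite [RHS]big_mkcond; apply: eq_bigr => s _; case: (s \in u).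
  rewrite sumr_const -[_ *+ _]mulr_natl card_notin // card_ord size_u -/k.
  by rewrite divff // gt_eqF.
have : expR (- n%:R) <= \sum_(s : 'S_n) \prod_j A j (s j).
  apply: permanent_ge.
  - by move=> j r; rewrite /A; case: ifP; rewrite // invr_ge0 ltW.
  - move=> j; apply: A_sum; last by rewrite size_map.
    rewrite uniq_pairwise pairwise_map; apply: sub_pairwise t_disc => q1 q2.
    by move=> /forallP/(_ j).
  (* The row q uses s in column q^-1 s, so the columns closed to s are the q^-1 s, pairwise distinct
     by discordance. *)
  - move=> s; rewrite -[RHS](A_sum [seq (q^-1)%g s | q : 'S_n <- t]) ?size_map //.
      apply: eq_bigr => j _; rewrite /A; congr (if _ then _ else _).
      by apply/mapP/mapP => -[q q_t ->]; exists q; rewrite ?permK ?permKV.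
    rewrite uniq_pairwise pairwise_map; apply: sub_pairwise t_disc => q1 q2.
    move=> /forallP/(_ ((q1^-1)%g s)) /=; rewrite permKV; apply: contraNneq => ->.
    by rewrite permKV.
rewrite (eq_bigr (fun s : 'S_n => if all (discordant s) t then k%:R ^- n else 0));
  last first.
  move=> s _; case: ifP => [/allP st|/allPn[q q_t]].
    rewrite (eq_bigr (fun=> k%:R^-1)) => [|j _].
      by rewrite prodr_const card_ord exprVn.
    rewrite /A; case: mapP => // -[q q_t sq].
    by have /forallP/(_ j) := st q q_t; rewrite sq eqxx.
  rewrite negb_forall => /existsP[j]; rewrite negbK => /eqP sq.
  by rewrite (bigD1 j) //= /A sq map_f ?mul0r.
rewrite -big_mkcond sumr_const -(mulr_natl (k%:R ^- n)) => le_card.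
by rewrite mulrC -ler_pdivlMr ?exprn_gt0.
Qed.

Lemma card_latin_rectangles_ge r : (r <= n)%N ->
  \prod_(k < r) ((n - k)%:R ^+ n * expR (- n%:R))
  <= #|[pred t : r.-tuple 'S_n | pairwise (@discordant n) t]|%:R :> R.
Proof.
elim: r => [_|r IH r_lt_n].
  rewrite big_ord0 ler1n; apply/card_gt0P; exists [tuple].
  by rewrite inE.
rewrite big_ord_recr /= -sum1_card natr_sum.
rewrite (big_tuple_cons r (pairwise (@discordant n)) (fun=> 1%:R)).
rewrite (exchange_big_dep (fun t : r.-tuple 'S_n => pairwise (@discordant n) t)) /=;
  last first.
  by move=> x t _ /andP[].
apply: (@le_trans _ _ (\sum_(t : r.-tuple 'S_n | pairwise (@discordant n) t)
                        (n - r)%:R ^+ n * expR (- n%:R))).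
  rewrite sumr_const -[leRHS]mulr_natl ler_wpM2r ?mulr_ge0 ?exprn_ge0 ?expR_ge0 //.
  by apply: le_trans (IH (ltnW r_lt_n)) _; rewrite ler_nat; apply/eq_leq/eq_card.
apply: ler_sum => t t_disc; rewrite (eq_bigl (fun x => all (discordant x) t)).
  rewrite sumr_const; have := @card_discordant_ge t; rewrite size_tuple.
  move=> /(_ r_lt_n t_disc)/le_trans; apply.
  by rewrite ler_nat; apply/eq_leq/eq_card.
by move=> x; rewrite t_disc andbT.
Qed.

(** The permanent bound for the constant matrix 1 / n, whose permanent is n! / n^n. *)
Lemma factorial_ge : (n%:R / expR 1) ^+ n <= n`!%:R :> R.
Proof.
have n0 : 0 < n%:R :> R by rewrite ltr0n.
have sum_n : \sum_(r < n) n%:R^-1 = 1 :> R.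
  by rewrite sumr_const card_ord -[_ *+ _]mulr_natl divff // gt_eqF.
have : expR (- n%:R) <= \sum_(s : 'S_n) \prod_(j < n) n%:R^-1 :> R.
  by apply: (@permanent_ge R m (fun _ _ => n%:R^-1)) => // *; rewrite invr_ge0 ltW.
rewrite sumr_const prodr_const card_ord -(mulr_natl (_ ^+ _)) exprVn.
rewrite ler_pdivlMr ?exprn_gt0 // card_Sn; apply: le_trans.
by rewrite exprMn exprVn -expRM_natr mul1r expRN mulrC.
Qed.

(** The row-by-row bounds multiply to (n!)^n e^(-n^2), and n! >= (n / e)^n. *)
Lemma card_latin_squares_ge :
  expR (n%:R ^+ 2 * (ln n%:R - 2)) <= #|latin_squares n|%:R :> R.
Proof.
have n0 : 0 < n%:R :> R by rewrite ltr0n.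
have -> : #|latin_squares n|
    = #|[pred t : n.-tuple 'S_n | pairwise (@discordant n) t]|.
  by apply: eq_card => L; rewrite inE is_latin_squareE.
apply: le_trans (card_latin_rectangles_ge (leqnn n)).
rewrite big_split /= prodrXl prodr_const card_ord -expRM_natr.
have -> : \prod_(k < n) (n - k)%:R = n`!%:R :> R.
  by rewrite -ffactnn ffact_prod natr_prod.
rewrite mulNr -expr2.
have -> : expR (n%:R ^+ 2 * (ln n%:R - 2))
  = ((n%:R / expR 1) ^+ n) ^+ n * expR (- n%:R ^+ 2) :> R.
  rewrite -exprM -(_ : expR (ln n%:R - 1) = n%:R / expR 1); last first.
    by rewrite expRD expRN lnK ?posrE.
  rewrite -expRM_natr -expRD natrM.
  by congr expR; ring.
by rewrite ler_pM2r ?expR_gt0 // lerXn2r ?nnegrE ?factorial_ge //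
  exprn_ge0 // divr_ge0 ?expR_ge0.
Qed.

End LatinCount.

(** * Sequential sampling in a random order *)

Section SequentialSampling.
Variables (R : realType) (T : finType).
Implicit Types (K : seq T -> T -> R) (p : seq T).

(** With K p x the probability of drawing x after the history p, this is the probability of
    continuing p by t. *)
Fixpoint seqprod K p (t : seq T) : R :=
  if t is x :: t' then K p x * seqprod K (rcons p x) t' else 1.

Lemma seqprodE K p t x0 m : size t = m ->
  seqprod K p t = \prod_(k < m) K (p ++ take k t) (nth x0 t k).
Proof.
elim: t p m => [|x t IH] p [|m] //= => [_|[size_t]]; first by rewrite big_ord0.
rewrite big_ord_recl /= cats0 (IH _ m) //; congr (_ * _); apply: eq_bigr => k _.
by rewrite /= cat_rcons.
Qed.

Lemma seqprod_ge0 K p t : (forall q x, 0 <= K q x) -> 0 <= seqprod K p t.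
Proof. by move=> K0; elim: t p => //= x t IH p; rewrite mulr_ge0. Qed.

Lemma sum_seqprod_le1 K m p : (forall q x, 0 <= K q x) ->
  (forall q, \sum_x K q x <= 1) ->
  \sum_(t : m.-tuple T) seqprod K p t <= 1.
Proof.
move=> K0 K1; elim: m p => [|m IH] p.
  rewrite (big_pred1 [tuple]) //= => t.
  by apply/esym/eqP; exact: tuple0.
rewrite (big_tuple_cons m xpredT (seqprod K p)) /=.
apply: le_trans (K1 p); apply: ler_sum => x _.
by rewrite -mulr_sumr ler_piMr.
Qed.

End SequentialSampling.

Section RandomOrder.
Variables (R : realType) (m : nat).
Let n := m.+1.

(* A permutation s maps ranks to elements: s^-1 x is the rank of x, and given
   that s a has rank a, any other element comes later with probability
   (m - a) / m. *)
Lemma sum_perm_later (a : 'I_n) (h : 'I_n -> R) (g : 'I_n -> 'I_n) :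
  (forall i, g i = i -> h i = 0) ->
  m%:R * \sum_(s : 'S_n) h (s a) * (a < (s^-1)%g (g (s a)))%:R
  = (m - a)%:R * \sum_(s : 'S_n) h (s a).
Proof.
move=> hg; pose C a' := \sum_(s : 'S_n) h (s a) * (s a' == g (s a))%:R.
have C_eq a1 a2 : a1 != a -> a2 != a -> C a1 = C a2.
  move=> a1a a2a; rewrite /C (reindex_inj (mulgI (tperm a1 a2))) /=.
  apply: eq_bigr => s _; rewrite !permM tpermL tpermD //.
have C_sum : \sum_(a' | a' != a) C a' = \sum_(s : 'S_n) h (s a).
  rewrite exchange_big /=; apply: eq_bigr => s _; rewrite -mulr_sumr.
  have [gsa|gsa] := eqVneq (g (s a)) (s a); first by rewrite hg ?mul0r.
  rewrite (bigD1 ((s^-1)%g (g (s a)))) /=; last first.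
    by apply: contra_neq gsa => /(congr1 s); rewrite permKV.
  rewrite permKV eqxx big1 ?addr0 ?mulr1 // => a' /andP[_ a'_neq].
  by case: eqP => // sa'; rewrite -sa' permK eqxx in a'_neq.
have -> : \sum_(s : 'S_n) h (s a) * (a < (s^-1)%g (g (s a)))%:R
          = \sum_(a' : 'I_n | (a < a')%N) C a'.
  rewrite exchange_big /=; apply: eq_bigr => s _; rewrite -mulr_sumr.
  congr (_ * _); case: ltnP => [lt_a|le_a].
    rewrite (bigD1 ((s^-1)%g (g (s a)))) //= permKV eqxx big1 ?addr0 //.
    move=> a' /andP[_ a'_neq].
    by case: eqP => // sa'; rewrite -sa' permK eqxx in a'_neq.
  rewrite big1 // => a' lt_a; case: eqP => // sa'.
  by move: le_a; rewrite -sa' permK leqNgt lt_a.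
rewrite mulr_sumr (eq_bigr (fun=> \sum_(s : 'S_n) h (s a))) => [|a' lt_a].
  rewrite sumr_const -(mulr_natl (\sum_s _)); congr (_%:R * _).
  rewrite -sum1_card -(big_geq_mkord a.+1 n xpredT (fun=> 1%N)).
  by rewrite sum_nat_const_nat muln1 subSS.
have a'a : a' != a by rewrite neq_ltn lt_a orbT.
rewrite -C_sum (eq_bigr (fun=> C a')) => [|a2 a2a]; last exact: C_eq.
rewrite sumr_const -(mulr_natl (C a')); congr (_%:R * _).
have := cardC1 a; rewrite card_ord /= => <-.
by apply: eq_card => x.
Qed.

End RandomOrder.

Section GreedyFilling.
Variables (R : realType) (m : nat).
Let n := m.+1.
Implicit Types (X : 'I_n -> 'I_n -> 'I_n) (v : 'I_n -> 'I_n -> 'I_n -> R).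

(* The order of filling is row by row, each row from left to right; other orders
   are obtained by permuting the rows and columns of X. *)
Definition available X (i j s : 'I_n) : bool :=
  [forall j' : 'I_n, (j' < j)%N ==> (X i j' != s)]
  && [forall i' : 'I_n, (i' < i)%N ==> (X i' j != s)].

Definition available_weight v X (i j : 'I_n) : R :=
  \sum_(s | available X i j s) v i j s.

Lemma available_self X (i j : 'I_n) :
  (forall i, injective (X i)) -> (forall j, injective (X^~ j)) ->
  available X i j (X i j).
Proof.
move=> row_inj col_inj; apply/andP; split; apply/forallP => k; apply/implyP => lt_k.
  by rewrite (inj_eq (row_inj i)) neq_ltn lt_k.
by rewrite (inj_eq (col_inj j)) neq_ltn lt_k.
Qed.

Lemma mem_take_enum (i k : 'I_n) : (k \in take i (enum 'I_n)) = (k < i)%N.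
Proof. by rewrite in_take ?mem_enum // index_enum_ord. Qed.

(* The summand is the probability that sequential sampling produces X b. *)
Lemma sum_greedy_le1 (I : finType) (B : {set I})
    (X : I -> 'I_n -> 'I_n -> 'I_n) v :
  (forall i j s, 0 < v i j s) ->
  (forall b i, b \in B -> injective (X b i)) ->
  (forall b j, b \in B -> injective ((X b)^~ j)) ->
  {in B &, forall b b', X b =2 X b' -> b = b'} ->
  \sum_(b in B) \prod_i \prod_j
     (v i j (X b i j) / available_weight v (X b) i j) <= 1.
Proof.
move=> v0 row_inj col_inj X_inj.
(* The sampling is nested: p lists the completed rows, q the filled cells of the current row, and
   their sizes give the position of the next cell. *)
pose ok (p : seq (n.-tuple 'I_n)) (q : seq 'I_n) (s : 'I_n) :=
  (s \notin q) && all (fun r : n.-tuple 'I_n => nth ord0 r (size q) != s) p.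
pose vpq (p : seq (n.-tuple 'I_n)) (q : seq 'I_n) s : R :=
  v (inord (size p)) (inord (size q)) s.
(* If no symbol is available every value is 0, so [kc] has total mass 0 or 1. *)
pose kc p q s : R :=
  if ok p q s then vpq p q s / \sum_(s' | ok p q s') vpq p q s' else 0.
pose K p (r : n.-tuple 'I_n) : R := seqprod (kc p) [::] r.
have vpq0 p q s : 0 <= vpq p q s by exact: ltW (v0 _ _ _).
have kc0 p q s : 0 <= kc p q s.
  by rewrite /kc; case: ifP => // _; rewrite divr_ge0 ?sumr_ge0.
have kc1 p q : \sum_s kc p q s <= 1.
  rewrite /kc -big_mkcond -mulr_suml /=.
  have [->|nz] := eqVneq (\sum_(s' | ok p q s') vpq p q s') 0.
    by rewrite mul0r ler01.
  by rewrite divff.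
pose tup b := [tuple [tuple X b i j | j < n] | i < n].
have tup_inj : {in B &, injective tup}.
  move=> b b' bB b'B tup_eq; apply: X_inj => // i j.
  have := congr1 (fun t => tnth (tnth t i) j) tup_eq.
  by rewrite !tnth_mktuple.
have tupE b : b \in B -> seqprod K [::] (tup b)
    = \prod_i \prod_j (v i j (X b i j) / available_weight v (X b) i j).
  move=> bB; rewrite (seqprodE K [::] [tuple ord0 | _ < n] (size_tuple _)).
  apply: eq_bigr => i _; rewrite nth_mktuple /K.
  rewrite (seqprodE _ _ ord0 (size_tuple [tuple X b i j | j < n])); apply: eq_bigr => j _.
  rewrite nth_mktuple /=.
  set p := take i _; set q := take j _.
  have size_p : size p = i by rewrite size_takel // size_map size_enum_ord ltnW.
  have size_q : size q = j by rewrite size_takel // size_map size_enum_ord ltnW.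
  have okE s : ok p q s = available (X b) i j s.
    rewrite /ok /available size_q; congr (_ && _).
      rewrite /q -map_take; apply/idP/forallP => [/mapP s_notin k|s_notin].
        apply/implyP => lt_k; apply/eqP => def_s; apply: s_notin.
        by exists k; rewrite ?mem_take_enum.
      apply/mapP => -[k]; rewrite mem_take_enum => lt_k def_s.
      by have := s_notin k; rewrite lt_k def_s eqxx.
    rewrite /p -map_take; apply/allP/forallP => [all_s k|all_s r /mapP[k]].
      apply/implyP => lt_k; rewrite -(nth_mktuple (X b k) ord0 j).
      by apply: all_s; apply/mapP; exists k; rewrite ?mem_take_enum.
    rewrite mem_take_enum => lt_k ->; rewrite nth_mktuple.
    by have := all_s k; rewrite lt_k.
  have self : available (X b) i j (X b i j).
    by apply: available_self => k; [exact: row_inj | exact: col_inj].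
  rewrite /kc okE self.
  rewrite /vpq size_p size_q !inord_val; congr (_ / _).
  exact: eq_bigl.
rewrite (eq_bigr _ (fun b bB => esym (tupE b bB))).
rewrite -(big_imset (fun t : n.-tuple (n.-tuple 'I_n) => seqprod K [::] t)) //=.
have K0 p r : 0 <= K p r by exact: seqprod_ge0.
have K1 p : \sum_r K p r <= 1 by exact: sum_seqprod_le1.
apply: le_trans (sum_seqprod_le1 n [::] K0 K1).
rewrite big_mkcond; apply: ler_sum => t _.
by case: ifP => // _; exact: seqprod_ge0.
Qed.

End GreedyFilling.

(** From y^-1 >= exp(1 - y) and exp u >= 1 + u. The bound is linear in the y i, so only their means
    matter when averaging over orders. *)
Lemma prod_inv_ge (R : realType) (I : finType) (y : I -> R) : (forall i, 0 < y i) ->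
  1 + \sum_i (1 - y i) <= \prod_i (y i)^-1.
Proof.
move=> y0; apply: le_trans (expR_ge1Dx _) _; rewrite expR_sum.
apply: ler_prod => i _; rewrite expR_ge0 /= -[leRHS]mul1r ler_pdivlMr //.
rewrite -ler_pdivlMl ?expR_gt0 // mulr1 -expRN opprB.
by have := expR_ge1Dx (y i - 1); rewrite addrC subrK.
Qed.

Section RandomOrderAverage.
Variables (R : realType) (m : nat).
Hypothesis m_gt0 : (0 < m)%N.
Let n := m.+1.
Implicit Types (i j s a b : 'I_n) (sg rh : 'S_n).

(** The probability that a fixed element, different from the one of rank a, has rank larger than
    a. *)
Definition later_fraction (a : 'I_n) : R := (m - a)%:R / m%:R.

Local Notation al := later_fraction.
Local Notation N := (#|{perm 'I_n}|%:R ^+ 2 : R).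

Definition reordered (X : 'I_n -> 'I_n -> 'I_n) sg rh i j := X (sg i) (rh j).

(** The symbol of the cell itself contributes at most q. Any other s is available only if its row in
    column rh b and its column in row sg a both come later, which has probability al a * al b. Here
    N counts the pairs of orders. *)
Lemma sum_available_le (X rowpos colpos : 'I_n -> 'I_n -> 'I_n)
    (p : 'I_n -> 'I_n -> 'I_n -> R) (q : R) a b :
  (forall j s, X (rowpos j s) j = s) -> (forall i s, X i (colpos i s) = s) ->
  (forall i j s, 0 <= p i j s <= q) -> (forall i j, \sum_s p i j s <= 1) ->
  \sum_(sg : 'S_n) \sum_(rh : 'S_n) \sum_(s | available (reordered X sg rh) a b s)
    p (sg a) (rh b) s
  <= N * (q + al a * al b).
Proof.
move=> rowposK colposK p_bound p_sum.
have m0 : 0 < m%:R :> R by rewrite ltr0n.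
have p0 i j s : 0 <= p i j s by have /andP[] := p_bound i j s.
(* Excluding the symbol of the cell gives the vanishing at fixed points required by
   [sum_perm_later]. *)
pose P i j s := if s == X i j then 0 else p i j s.
have P0 i j s : 0 <= P i j s by rewrite /P; case: ifP.
pose later_row sg rh s : R := (a < (sg^-1)%g (rowpos (rh b) s))%:R.
pose later_col sg rh s : R := (b < (rh^-1)%g (colpos (sg a) s))%:R.
pose Q sg rh s := P (sg a) (rh b) s * later_col sg rh s.
have N_sum (x : R) : \sum_(sg : 'S_n) \sum_(rh : 'S_n) x = N * x.
  by rewrite !sumr_const -mulrnA -(mulr_natl x) natrM expr2.
apply: (@le_trans _ _ (\sum_(sg : 'S_n) \sum_(rh : 'S_n)
                          (q + \sum_s Q sg rh s * later_row sg rh s))).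
  apply: ler_sum => sg _; apply: ler_sum => rh _.
  have -> : q = \sum_s (if s == X (sg a) (rh b) then q else 0).
    by rewrite -big_mkcond big_pred1_eq.
  rewrite big_mkcond -big_split; apply: ler_sum => s _ /=.
  have Q0 : 0 <= Q sg rh s * later_row sg rh s.
    by rewrite /Q /later_row /later_col !mulr_ge0 ?ler0n.
  have q0 : 0 <= q by have /andP[/le_trans] := p_bound a a a; apply.
  case: ifP => [/andP[/forallP row_av /forallP col_av]|_]; last first.
    by rewrite addr_ge0 //; case: ifP.
  have [s_X|s_X] := eqVneq s (X (sg a) (rh b)).
    by rewrite ler_wpDr //; have /andP[] := p_bound (sg a) (rh b) s.
  rewrite add0r /Q /later_row /later_col /P (negPf s_X).
  have -> : (a < (sg^-1)%g (rowpos (rh b) s))%N.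
    rewrite ltnNge leq_eqVlt; apply/norP; split; last first.
      apply/negP => lt_a; have := col_av ((sg^-1)%g (rowpos (rh b) s)).
      by rewrite lt_a /reordered permKV rowposK eqxx.
    apply: contra_neq s_X => /val_inj def_a.
    by rewrite -def_a permKV rowposK.
  have -> : (b < (rh^-1)%g (colpos (sg a) s))%N.
    rewrite ltnNge leq_eqVlt; apply/norP; split; last first.
      apply/negP => lt_b; have := row_av ((rh^-1)%g (colpos (sg a) s)).
      by rewrite lt_b /reordered permKV colposK eqxx.
    apply: contra_neq s_X => /val_inj def_b.
    by rewrite -def_b permKV colposK.
  by rewrite !mulr1.
rewrite (eq_bigr (fun sg => \sum_(rh : 'S_n) q
    + \sum_(rh : 'S_n) \sum_s Q sg rh s * later_row sg rh s)) => [|sg _]; last first.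
  by rewrite big_split.
rewrite big_split /= N_sum mulrDr lerD2l.
set S1 := \sum_sg _.
(* With rh fixed, the column condition depends on sg only through sg a, so it is part of the weight
   when averaging over sg. The average over rh comes next. *)
have S1E : m%:R * S1
    = (m - a)%:R * (\sum_(sg : 'S_n) \sum_(rh : 'S_n) \sum_s Q sg rh s).
  rewrite /S1 exchange_big [in RHS]exchange_big /= !mulr_sumr.
  apply: eq_bigr => rh _; rewrite exchange_big [in RHS]exchange_big /= !mulr_sumr.
  apply: eq_bigr => s _.
  apply: (@sum_perm_later R m a
    (fun i => P i (rh b) s * (b < (rh^-1)%g (colpos i s))%:R)
    (fun=> rowpos (rh b) s)) => i def_i.
  by rewrite /P -def_i rowposK eqxx mul0r.
have S2E : m%:R * (\sum_(sg : 'S_n) \sum_(rh : 'S_n) \sum_s Q sg rh s)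
    = (m - b)%:R * (\sum_(sg : 'S_n) \sum_(rh : 'S_n) \sum_s P (sg a) (rh b) s).
  rewrite !mulr_sumr.
  apply: eq_bigr => sg _; rewrite exchange_big [in RHS]exchange_big /= !mulr_sumr.
  apply: eq_bigr => s _.
  apply: (@sum_perm_later R m b (fun j => P (sg a) j s)
    (fun=> colpos (sg a) s)) => j def_j.
  by rewrite /P -def_j colposK eqxx.
have S3_le : \sum_(sg : 'S_n) \sum_(rh : 'S_n) \sum_s P (sg a) (rh b) s <= N.
  rewrite -[leRHS]mulr1 -N_sum; apply: ler_sum => sg _; apply: ler_sum => rh _.
  apply: le_trans (p_sum (sg a) (rh b)); apply: ler_sum => s _.
  by rewrite /P; case: ifP.
have -> : S1 = al a * al b * \sum_(sg : 'S_n) \sum_(rh : 'S_n) \sum_s P (sg a) (rh b) s.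
  apply: (mulfI (lt0r_neq0 m0)); rewrite S1E; apply: (mulfI (lt0r_neq0 m0)).
  rewrite mulrCA S2E /later_fraction; field; exact: lt0r_neq0.
by rewrite mulrC ler_wpM2r // mulr_ge0 // divr_ge0 ?ler0n.
Qed.

End RandomOrderAverage.

(** * Upper bound on the total weight of a family of Latin squares *)

Section WeightedCount.
Variables (R : realType) (m : nat).
Hypothesis m_gt0 : (0 < m)%N.
Let n := m.+1.
Variables (w : 'I_n -> 'I_n -> 'I_n -> R) (q e : R).
Hypothesis w_gt0 : forall i j s, 0 < w i j s.
Let W i j := \sum_s w i j s.
Hypothesis w_le : forall i j s, w i j s <= q * W i j.
Hypotheses (e_gt0 : 0 < e) (q_le : q <= e ^+ 2).

Local Notation al := (@later_fraction R m).
Local Notation N := (#|{perm 'I_n}|%:R ^+ 2 : R).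

Lemma latin_col_inj (L : n.-tuple 'S_n) j :
  L \in latin_squares n -> injective (fun i => tnth L i j).
Proof.
rewrite inE is_latin_squareE => /(pairwiseP 1%g) L_disc i k.
have lt_neq (i1 i2 : 'I_n) : (i1 < i2)%N -> tnth L i1 j != tnth L i2 j.
  move=> lt12; have := L_disc i1 i2; rewrite !inE size_tuple => /(_ _ _ lt12).
  by rewrite !(tnth_nth 1%g) => /(_ _ _)/forallP; apply.
have [lt|lt|/val_inj //] := ltngtP i k => eq_ik.
  by have := lt_neq _ _ lt; rewrite eq_ik eqxx.
by have := lt_neq _ _ lt; rewrite eq_ik eqxx.
Qed.

(** The shift e keeps the factors positive at the last rank, where al vanishes, and its square
    absorbs q. *)
Let M (sg rh : 'S_n) a b := W (sg a) (rh b) * ((e + al a) * (e + al b)).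
Let entry (L : n.-tuple 'S_n) i j := tnth L i j.

Lemma weight_sum_gt0 i j : 0 < W i j.
Proof.
rewrite /W (bigD1 ord0) //= ltr_pwDl // sumr_ge0 // => s _; exact: ltW.
Qed.

Lemma later_fraction_ge0 a : 0 <= al a. Proof. by rewrite divr_ge0 ?ler0n. Qed.

Lemma mean_weight_gt0 sg rh a b : 0 < M sg rh a b.
Proof. by rewrite !mulr_gt0 ?weight_sum_gt0 // ltr_pwDl ?later_fraction_ge0. Qed.

Lemma prod_mean_weight sg rh : \prod_a \prod_b M sg rh a b
  = \prod_i \prod_j W i j * \prod_(a < n) \prod_(b < n) ((e + al a) * (e + al b)).
Proof.
rewrite [in RHS](reindex_inj (@perm_inj _ sg)) -big_split; apply: eq_bigr => a _ /=.
by rewrite [in RHS](reindex_inj (@perm_inj _ rh)) -big_split.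
Qed.

(* The factor at a cell is at least 1 on average over sg and rh, because M bounds
   the mean of the available weight; prod_inv_ge passes to the product. *)
Lemma sum_order_ge (L : n.-tuple 'S_n) : L \in latin_squares n ->
  N <= \sum_(sg : 'S_n) \sum_(rh : 'S_n) \prod_a \prod_b
         (M sg rh a b / available_weight (fun i j s => w (sg i) (rh j) s)
                          (reordered (entry L) sg rh) a b).
Proof.
move=> L_latin.
pose Z (sg rh : 'S_n) := available_weight (fun i j s => w (sg i) (rh j) s)
                                 (reordered (entry L) sg rh).
have Z0 sg rh a b : 0 < Z sg rh a b.
  rewrite /Z /available_weight (bigD1 (reordered (entry L) sg rh a b)) /=.
    by rewrite ltr_pwDl // sumr_ge0 // => s _; exact: ltW.
  apply: available_self => k x y; first by move=> /perm_inj/perm_inj.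
  by move=> /(latin_col_inj L_latin)/perm_inj.
pose y (sg rh : 'S_n) (ab : 'I_n * 'I_n) := Z sg rh ab.1 ab.2 / M sg rh ab.1 ab.2.
have y0 sg rh ab : 0 < y sg rh ab by rewrite divr_gt0 ?mean_weight_gt0.
have avg ab : \sum_(sg : 'S_n) \sum_(rh : 'S_n) y sg rh ab <= N.
  case: ab => a b; rewrite /y /=.
  pose c := (e + al a) * (e + al b).
  have c0 : 0 < c by rewrite mulr_gt0 // ltr_pwDl ?later_fraction_ge0.
  pose rowpos j s := invF (latin_col_inj (j := j) L_latin) s.
  pose colpos i s := ((tnth L i)^-1)%g s.
  have le_avg : \sum_(sg : 'S_n) \sum_(rh : 'S_n)
      \sum_(s | available (reordered (entry L) sg rh) a b s)
        w (sg a) (rh b) s / W (sg a) (rh b) <= N * (q + al a * al b).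
    apply: (@sum_available_le R m m_gt0 (entry L) rowpos colpos
              (fun i j s => w i j s / W i j)).
    - by move=> j s; rewrite /entry -[LHS]/((fun i => tnth L i j) _) f_invF.
    - by move=> i s; rewrite /entry permKV.
    - move=> i j s; rewrite divr_ge0 ?(ltW (weight_sum_gt0 _ _)) ?(ltW (w_gt0 _ _ _)) //=.
      by rewrite ler_pdivrMr ?weight_sum_gt0.
    - by move=> i j; rewrite -mulr_suml divff // gt_eqF ?weight_sum_gt0.
  have -> : \sum_sg \sum_rh Z sg rh a b / M sg rh a b
    = (\sum_(sg : 'S_n) \sum_(rh : 'S_n)
        \sum_(s | available (reordered (entry L) sg rh) a b s)
          w (sg a) (rh b) s / W (sg a) (rh b)) / c.
    rewrite mulr_suml; apply: eq_bigr => sg _; rewrite mulr_suml.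
    by apply: eq_bigr => rh _; rewrite -mulr_suml /M invfM mulrA.
  (* q <= e^2 gives q + al a * al b <= (e + al a)(e + al b). *)
  rewrite ler_pdivrMr //; apply: le_trans le_avg _; rewrite ler_wpM2l ?sqr_ge0 //.
  have := later_fraction_ge0 a; have := later_fraction_ge0 b; rewrite /c.
  move: (al a) (al b) => x z x0 z0.
  by move: e_gt0 q_le => e0 qe; nra.
have N_sum (x : R) : \sum_(sg : 'S_n) \sum_(rh : 'S_n) x = N * x.
  by rewrite !sumr_const -mulrnA -(mulr_natl x) natrM expr2.
apply: (@le_trans _ _ (\sum_(sg : 'S_n) \sum_(rh : 'S_n)
                          (1 + \sum_ab (1 - y sg rh ab)))); last first.
  apply: ler_sum => sg _; apply: ler_sum => rh _.
  apply: le_trans (prod_inv_ge (y0 sg rh)) _.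
  rewrite pair_big /= le_eqVlt; apply/orP; left; apply/eqP.
  by apply: eq_bigr => ab _; rewrite /y invf_div.
rewrite (eq_bigr (fun sg : 'S_n => \sum_(rh : 'S_n) 1
   + \sum_(rh : 'S_n) \sum_ab (1 - y sg rh ab))) => [|sg _]; last by rewrite big_split.
rewrite big_split N_sum mulr1 /= lerDl.
rewrite (eq_bigr (fun sg : 'S_n => \sum_ab \sum_(rh : 'S_n) (1 - y sg rh ab))) => [|sg _];
  last by rewrite exchange_big.
rewrite exchange_big /= sumr_ge0 // => ab _.
rewrite (eq_bigr (fun sg : 'S_n => \sum_(rh : 'S_n) 1 - \sum_(rh : 'S_n) y sg rh ab)) =>
  [|sg _]; last by rewrite sumrB.
by rewrite sumrB N_sum mulr1 subr_ge0.
Qed.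

(** Multiply the weight of each L by the bound of [sum_order_ge]. For a fixed order the product is U
    times the probability of sampling L, since the product of the M does not depend on the order;
    these probabilities sum to at most 1. *)
Lemma weighted_latin_count_le (B : {set n.-tuple 'S_n}) :
  B \subset latin_squares n ->
  \sum_(L in B) \prod_i \prod_j w i j (tnth L i j)
  <= \prod_i \prod_j W i j * \prod_(a < n) \prod_(b < n) ((e + al a) * (e + al b)).
Proof.
move=> /subsetP B_latin; set U := _ * _.
have N0 : 0 < N by rewrite exprn_gt0 // ltr0n; apply/card_gt0P; exists 1%g.
have UE sg rh : U = \prod_a \prod_b M sg rh a b by rewrite prod_mean_weight.
have U0 : 0 <= U.
  by rewrite (UE 1%g 1%g) prodr_ge0 // => i _; rewrite prodr_ge0 // => j _;
    rewrite ltW ?mean_weight_gt0.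
rewrite -(ler_pM2l N0).
pose D (sg rh : 'S_n) (L : n.-tuple 'S_n) a b := w (sg a) (rh b) (entry L (sg a) (rh b))
  / available_weight (fun i j s => w (sg i) (rh j) s) (reordered (entry L) sg rh) a b.
apply: (@le_trans _ _ (\sum_(L in B) \sum_(sg : 'S_n) \sum_(rh : 'S_n)
                         U * \prod_a \prod_b D sg rh L a b)).
  rewrite mulr_sumr; apply: ler_sum => L /B_latin L_latin.
  have w0 : 0 <= \prod_i \prod_j w i j (tnth L i j).
    by rewrite prodr_ge0 // => i _; rewrite prodr_ge0 // => j _; rewrite ltW.
  apply: le_trans (ler_wpM2r w0 (sum_order_ge L_latin)) _.
  rewrite mulr_suml; apply: ler_sum => sg _; rewrite mulr_suml; apply: ler_sum => rh _.
  have -> : \prod_i \prod_j w i j (tnth L i j)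
    = \prod_a \prod_b w (sg a) (rh b) (entry L (sg a) (rh b)).
    rewrite (reindex_inj (@perm_inj _ sg)); apply: eq_bigr => a _.
    by rewrite (reindex_inj (@perm_inj _ rh)).
  rewrite (UE sg rh) -!big_split /= le_eqVlt; apply/orP; left; apply/eqP.
  apply: eq_bigr => a _; rewrite -!big_split /=; apply: eq_bigr => b _.
  by rewrite /D [RHS]mulrCA mulrC.
rewrite exchange_big; have N_sum : N * U = \sum_(sg : 'S_n) \sum_(rh : 'S_n) U.
  by rewrite !sumr_const -mulrnA -(mulr_natl U) natrM expr2.
rewrite N_sum; apply: ler_sum => sg _; rewrite exchange_big /=.
apply: ler_sum => rh _; rewrite -mulr_sumr -[leRHS]mulr1 ler_wpM2l //.
apply: (@sum_greedy_le1 R m _ B (fun L => reordered (entry L) sg rh)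
          (fun i j s => w (sg i) (rh j) s)) => //.
- by move=> L i _ x y /perm_inj/perm_inj.
- by move=> L j /B_latin L_latin x y /(latin_col_inj L_latin)/perm_inj.
- move=> L L' _ _ LL'; apply: eq_from_tnth => i; apply/permP => j.
  by have := LL' ((sg^-1)%g i) ((rh^-1)%g j); rewrite /reordered !permKV.
Qed.

End WeightedCount.

(** * Numerical and combinatorial estimates *)

Section RiemannSum.
Variable R : realType.

(** A left Riemann step for the increasing function ln, with antiderivative x ln x - x. *)
Lemma mul_ln_le_diff (x h : R) : 0 < x -> 0 < h ->
  h * ln x <= ((x + h) * ln (x + h) - (x + h)) - (x * ln x - x).
Proof.
move=> x0 h0; have xh0 : 0 < x + h by rewrite addr_gt0.
have ln_xh : ln x - ln (x + h) <= x / (x + h) - 1.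
  by rewrite -ln_div ?posrE // ln_le_subr1 // divr_gt0.
have := ler_wpM2l (ltW xh0) ln_xh.
by rewrite (mulrBr _ (x / _)) (mulrC _ (x / _)) mulfVK ?gt_eqF //; lra.
Qed.

(** The logarithm is a Riemann sum of ln with step h = 1 / m, starting at e = th^2. Taking a square
    makes the boundary term - e ln e at most 2 th. *)
Lemma prod_later_fraction_le m (th : R) : (0 < m)%N -> 0 < th <= 1 ->
  m%:R^-1 <= th ^+ 2 ->
  \prod_(a < m.+1) (th ^+ 2 + later_fraction R a)
  <= expR (m.+1%:R * (8 * th - 1)).
Proof.
move=> m_gt0 /andP[th0 th1] m_le; set e := th ^+ 2; set h : R := m%:R^-1.
have m0 : 0 < m%:R :> R by rewrite ltr0n.
have h0 : 0 < h by rewrite /h invr_gt0.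
have e0 : 0 < e by rewrite exprn_gt0.
have e1 : e <= 1 by rewrite /e expr2; nra.
pose G (x : R) := x * ln x - x.
have lin0 (k : nat) : 0 < e + k%:R * h by rewrite ltr_pwDl // mulr_ge0 ?ler0n ?(ltW h0).
have -> : \prod_(a < m.+1) (e + later_fraction R a)
          = expR (\sum_(k < m.+1) ln (e + k%:R * h)).
  (* Reversing the ranks turns (m - a) / m into k / m. *)
  rewrite expR_sum (reindex_inj rev_ord_inj) /=; apply: eq_bigr => k _.
  rewrite lnK ?posrE // /later_fraction /=; congr (_ + _%:R * _).
  by rewrite subSS subKn // -ltnS.
have riemann r : \sum_(k < r) h * ln (e + k%:R * h) <= G (e + r%:R * h) - G e.
  elim: r => [|r IH]; first by rewrite big_ord0 mul0r addr0 subrr.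
  rewrite big_ord_recr /=.
  have := mul_ln_le_diff (lin0 r) h0; rewrite -/(G _) -/(G (e + r%:R * h)).
  rewrite (_ : e + r%:R * h + h = e + r.+1%:R * h) -/(G _);
    last by rewrite -natr1; ring.
  by move: IH; rewrite -/(G _); lra.
rewrite ler_expR -(ler_pM2l h0) mulr_sumr; apply: le_trans (riemann _) _.
(* The m + 1 steps of length 1 / m end at 1 + e + h. *)
set y := e + m.+1%:R * h.
have def_y : y = 1 + e + h by rewrite /y -natr1 mulrDl /h divff ?gt_eqF //; ring.
have ln_y : ln y <= y - 1 by apply: ln_le_subr1; rewrite def_y !addr_gt0.
have ln_th : - ln th <= th^-1 - 1.
  by rewrite -lnV ?posrE //; apply: ln_le_subr1; rewrite invr_gt0.
have e_ln : - (e * ln e) <= 2 * th.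
  have -> : ln e = 2 * ln th by rewrite /e lnXn // mulr_natl.
  have -> : - (e * (2 * ln th)) = (2 * e) * (- ln th) by ring.
  apply: le_trans (ler_wpM2l _ ln_th) _; first by rewrite mulr_ge0 ?ltW.
  rewrite mulrBr mulr1 /e expr2 -!mulrA divff ?gt_eqF //; nra.
have y_ln : y * ln y <= 6 * e.
  apply: (@le_trans _ _ (y * (y - 1))).
    by rewrite ler_wpM2l // def_y; move: h0; lra.
  rewrite def_y; move: m_le h0; rewrite -/h -/e => he hh0; nra.
have e_th : e <= th by rewrite /e expr2; nra.
have mh : m.+1%:R * h = 1 + h by rewrite -natr1 mulrDl /h divff ?gt_eqF ?mul1r.
rewrite [leRHS](_ : _ = (1 + h) * (8 * th - 1)); last by rewrite -mh; ring.
rewrite /G def_y in y_ln *.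
have : 0 <= h * th by rewrite mulr_ge0 ?ltW.
by nra.
Qed.

End RiemannSum.

(** * Triangles of the tripartite complex *)

Section Triangles.
Variable n : nat.
Implicit Types (i j s : 'I_n) (E : {set {set vertex n}}) (L : n.-tuple 'S_n).

Definition triangle i j s : {set vertex n} := [set va i; vb j; vc s].

Lemma triangle_inj i j s i' j' s' :
  triangle i j s = triangle i' j' s' -> [/\ i = i', j = j' & s = s'].
Proof.
move=> /setP tri_eq; split.
- by have := tri_eq (va i); rewrite !inE eqxx /= !xpair_eqE /= !orbF => /esym/eqP.
- by have := tri_eq (vb j); rewrite !inE eqxx /= !xpair_eqE /= !orbF => /esym/eqP.
- by have := tri_eq (vc s); rewrite !inE eqxx /= !xpair_eqE /= ?orbT => /esym/eqP.
Qed.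

Lemma card_triangle i j s : #|triangle i j s| = 3.
Proof. by rewrite /triangle setUC cardsU1 cards2 !inE !xpair_eqE. Qed.

(** Three vertices with at most one in each of the three parts: if a part were missed, the other two
    would hold at most two. *)
Lemma triangle_of_face (f : {set vertex n}) :
  f \in simplices 2 (tripartite_complex n) -> exists i j s, f = triangle i j s.
Proof.
rewrite !inE => /andP[/forallP f_part /eqP card_f].
have card_sum : (\sum_k #|f :&: part n k| = 3)%N.
  rewrite -[RHS]card_f -[RHS]sum1_card.
  rewrite [RHS](partition_big (fun v : vertex n => v.1) xpredT) //=.
  apply: eq_bigr => k _; rewrite -sum1_card; apply: eq_bigl => v.
  by rewrite !inE.
have part1 k : exists x, (k, x) \in f.
  have /card_gt0P[[k' x]] : (0 < #|f :&: part n k|)%N.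
    move: card_sum; rewrite (bigD1 k) //=.
    have : (\sum_(k' | k' != k) #|f :&: part n k'| <= \sum_(k' : 'I_3 | k' != k) 1)%N.
      by apply: leq_sum.
    have -> : (\sum_(k' : 'I_3 | k' != k) 1 = 2)%N.
      rewrite sum1_card; apply: etrans (_ : #|predC1 k| = 2%N); first exact: eq_card.
      by rewrite cardC1 card_ord.
    move=> le2 sum3; rewrite lt0n; apply/eqP => k_empty.
    by rewrite k_empty add0n in sum3; rewrite sum3 in le2.
  by rewrite !inE /= => /andP[fx /eqP def_k]; exists x; rewrite -def_k.
have [i fi] := part1 (@Ordinal 3 0 isT).
have [j fj] := part1 (@Ordinal 3 1 isT).
have [s fs] := part1 (@Ordinal 3 2 isT).
exists i, j, s; apply/eqP; rewrite eq_sym eqEcard card_f card_triangle leqnn andbT.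
by apply/subsetP => v; rewrite !inE => /orP[/orP[]|] /eqP->.
Qed.

Lemma card_faces_le E : E \subset simplices 2 (tripartite_complex n) ->
  (#|E| <= \sum_i \sum_j #|[set s | triangle i j s \in E]|)%N.
Proof.
move=> /subsetP E_faces; pose tri (p : 'I_n * 'I_n * 'I_n) := triangle p.1.1 p.1.2 p.2.
have -> : (\sum_i \sum_j #|[set s | triangle i j s \in E]| = #|tri @^-1: E|)%N.
  transitivity (\sum_i \sum_j \sum_(s | triangle i j s \in E) 1)%N.
    by apply: eq_bigr => i _; apply: eq_bigr => j _; rewrite sum1_card cardsE.
  rewrite pair_big pair_big_dep /= -[RHS]sum1_card.
  by apply: eq_bigl => p; rewrite inE.
rewrite -(card_in_imset (f := tri)); last first.
  by move=> [[i j] s] [[i' j'] s'] _ _ /triangle_inj[/= -> -> ->].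
apply: subset_leq_card; apply/subsetP => f fE.
have [i [j [s def_f]]] := triangle_of_face (E_faces f fE).
by apply/imsetP; exists (i, j, s); rewrite ?inE /tri -?def_f.
Qed.

Lemma hits_ge E L :
  (#|[set ij : 'I_n * 'I_n | triangle ij.1 ij.2 (tnth L ij.1 ij.2) \in E]|
   <= hits E L)%N.
Proof.
rewrite -(card_in_imset (f := fun ij : 'I_n * 'I_n =>
                                triangle ij.1 ij.2 (tnth L ij.1 ij.2))); last first.
  by move=> [i j] [i' j'] _ _ /triangle_inj[/= -> -> _].
apply: subset_leq_card; apply/subsetP => f /imsetP[[i j]]; rewrite inE /= => fE ->.
rewrite !inE fE andbT card_triangle eqxx andbT.
by apply/orP; right; apply/imset2P; exists i j.
Qed.

End Triangles.

(** * The weight 2^-hits *)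

Section WeightedHits.
Variables (R : realType) (m : nat).
Let n := m.+1.
Variable E : {set {set vertex n}}.
Hypothesis E_faces : E \subset simplices 2 (tripartite_complex n).

Let w (i j s : 'I_n) : R := if triangle i j s \in E then 2^-1 else 1.
Let W i j := \sum_s w i j s.
Let d i j := #|[set s | triangle i j s \in E]|.

Lemma weight_sumE i j : W i j = n%:R - (d i j)%:R / 2.
Proof.
rewrite /W (eq_bigr (fun s => 1 - (if triangle i j s \in E then 2^-1 else 0))).
  rewrite sumrB sumr_const card_ord -big_mkcond sumr_const; congr (_ - _).
  by rewrite -(mulr_natl 2^-1) /d cardsE.
by move=> s _; rewrite /w; case: ifP => _; [field | rewrite subr0].
Qed.

(** Weights are at most 1 and at least 1/2, hence W i j >= n / 2. *)
Lemma weight_le_sum i j s : w i j s <= 2 / n%:R * W i j.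
Proof.
have n0 : 0 < n%:R :> R by rewrite ltr0n.
have d_le : (d i j)%:R <= n%:R :> R.
  by rewrite ler_nat -[leqRHS]card_ord max_card.
apply: (@le_trans _ _ 1); first by rewrite /w; case: ifP; lra.
by rewrite weight_sumE mulrAC ler_pdivlMr //; lra.
Qed.

(** Uses n - d / 2 <= n exp(- d / (2 n)) at each cell; the d i j add up to at least |E|. *)
Lemma prod_sum_weight_le : \prod_i \prod_j W i j
  <= expR (n%:R ^+ 2 * ln n%:R - #|E|%:R / (2 * n%:R)).
Proof.
have n0 : 0 < n%:R :> R by rewrite ltr0n.
apply: (@le_trans _ _
  (\prod_(i < n) \prod_(j < n) expR (ln n%:R - (d i j)%:R / (2 * n%:R)))).
  have W_bounds i j : 0 <= W i j <= expR (ln n%:R - (d i j)%:R / (2 * n%:R)).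
    apply/andP; split.
      by apply: sumr_ge0 => s _; rewrite /w; case: ifP; lra.
    rewrite expRD lnK ?posrE // weight_sumE.
    have := ler_wpM2l (ltW n0) (expR_ge1Dx (- ((d i j)%:R / (2 * n%:R) : R))).
    apply: le_trans; rewrite le_eqVlt; apply/orP; left; apply/eqP.
    by field; rewrite gt_eqF.
  apply: ler_prod => i _; rewrite prodr_ge0 /= => [|j _]; last first.
    by have /andP[] := W_bounds i j.
  by apply: ler_prod => j _.
under eq_bigr => i _ do rewrite -expR_sum.
rewrite -expR_sum ler_expR.
under eq_bigr => i _ do rewrite sumrB.
rewrite sumrB !sumr_const card_ord lerB //.
  by rewrite -mulrnA -(mulr_natl (ln _)) natrM expr2.
have := card_faces_le E_faces; rewrite -(ler_nat R) natr_sum => E_le.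
under eq_bigr => i _ do rewrite -mulr_suml.
rewrite -mulr_suml ler_pM2r ?invr_gt0 ?mulr_gt0 //; apply: le_trans E_le _.
by apply: ler_sum => i _; rewrite natr_sum.
Qed.

(** The weight is 2^-k for the number k of cells whose triangle is in E; k is at most [hits E L],
    and e >= 2. *)
Lemma prod_weight_ge (L : n.-tuple 'S_n) :
  expR (- (hits E L)%:R) <= \prod_i \prod_j w i j (tnth L i j).
Proof.
rewrite pair_big /= -big_mkcond prodr_const /=.
set k := #|_|.
have k_le : (k <= hits E L)%N.
  apply: leq_trans (hits_ge E L); rewrite cardsE; exact/eq_leq/eq_card.
apply: (@le_trans _ _ (expR (- k%:R))); first by rewrite ler_expR lerN2 ler_nat.
rewrite -[k%:R]mulr1 -mulrN mulrC expRM_natr.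
apply: lerXn2r; rewrite ?nnegrE ?expR_ge0 ?invr_ge0 ?ler0n //.
rewrite expRN lef_pV2 ?posrE ?expR_gt0 //.
by have := expR_ge1Dx (1 : R); lra.
Qed.

(** Markov's inequality: every square of B weighs at least e^-t. The smoothing parameter is e =
    th^2, with q = 2 / n. *)
Lemma card_few_hits_le (B : {set n.-tuple 'S_n}) (th t : R) :
  (0 < m)%N -> B \subset latin_squares n -> {in B, forall L, (hits E L)%:R <= t} ->
  0 < th <= 1 -> 2 / m%:R <= th ^+ 4 ->
  #|B|%:R <= expR (t + (n%:R ^+ 2 * ln n%:R - #|E|%:R / (2 * n%:R))
                   + 2 * n%:R ^+ 2 * (8 * th - 1)).
Proof.
move=> m_gt0 B_latin B_hits th01 th_m; have /andP[th0 th1] := th01.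
have m0 : 0 < m%:R :> R by rewrite ltr0n.
have n0 : 0 < n%:R :> R by rewrite ltr0n.
have e0 : 0 < th ^+ 2 by rewrite exprn_gt0.
have th_sq : th ^+ 4 <= th ^+ 2.
  by rewrite ler_wiXn2l // ltW.
have n_th : 2 / n%:R <= (th ^+ 2) ^+ 2.
  rewrite -exprM; apply: le_trans th_m; rewrite ler_pM2l //.
  by rewrite lef_pV2 ?posrE // ler_nat.
have m_th : m%:R^-1 <= th ^+ 2.
  apply: le_trans th_sq; apply: le_trans th_m.
  by rewrite ler_peMl ?invr_ge0 ?ler0n ?ler1n.
have w0 i j s : 0 < w i j s by rewrite /w; case: ifP; lra.
have := weighted_latin_count_le m_gt0 w0 weight_le_sum e0 n_th B_latin.
have low : #|B|%:R * expR (- t) <= \sum_(L in B) \prod_i \prod_j w i j (tnth L i j).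
  rewrite mulr_natl -sumr_const; apply: ler_sum => L LB.
  by apply: le_trans (prod_weight_ge L); rewrite ler_expR lerN2 B_hits.
move=> /(le_trans low); rewrite -ler_pdivlMr ?expR_gt0 // => /le_trans; apply.
rewrite -expRN opprK mulrC -addrA expRD ler_pM2l ?expR_gt0 // expRD.
have al0 (a : 'I_n) : 0 <= th ^+ 2 + later_fraction R a.
  by rewrite addr_ge0 ?(ltW e0) ?later_fraction_ge0.
have := prod_later_fraction_le m_gt0 th01 m_th.
set P := \prod_(a < m.+1) _ => P_le.
have -> : \prod_(a < n) \prod_(b < n)
    ((th ^+ 2 + later_fraction R a) * (th ^+ 2 + later_fraction R b))
    = P ^+ n * P ^+ n.
  under eq_bigr => a _ do rewrite big_split prodr_const card_ord.
  by rewrite big_split prodrXl prodr_const card_ord.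
have P0 : 0 <= P by apply: prodr_ge0.
apply: ler_pM; rewrite ?mulr_ge0 ?exprn_ge0 //.
- apply: prodr_ge0 => i _; apply: prodr_ge0 => j _.
  by apply: sumr_ge0 => s _; rewrite ltW.
- exact: prod_sum_weight_le.
have Pn : P ^+ n <= expR (n%:R * (n%:R * (8 * th - 1))).
  rewrite mulrC expRM_natr; apply: lerXn2r; rewrite ?nnegrE ?expR_ge0 //.
apply: le_trans (ler_pM _ _ Pn Pn) _; rewrite ?exprn_ge0 // -expRD ler_expR.
by rewrite le_eqVlt; apply/orP; left; apply/eqP; ring.
Qed.

End WeightedHits.

(** * Choice of parameters and comparison of the two counts *)

Theorem theorem4 (R : realType) (c : R) (c_gt0 : 0 < c) (c_le1 : c <= 1) :
  exists n0 : nat, forall n : nat, (n0 <= n)%N ->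
    forall E : {set {set vertex n}},
      E \subset simplices 2 (tripartite_complex n) ->
      c * n%:R ^+ 3 <= #|E|%:R ->
      uniform_pr R (latin_squares n)
        (fun L => (hits E L)%:R < 10%:R ^- 3 * c ^+ 2 * n%:R ^+ 2 :> R)
      < expR (- (10%:R ^- 3 * c ^+ 2 * n%:R ^+ 2)).
Proof.
(* The error 16 th n^2 = 2 c n^2 / 5 leaves c n^2 / 10 of the gain c n^2 / 2. This exceeds 2 t: one
   t comes from Markov's inequality, the other from the target bound. *)
pose th := c / 40.
have th0 : 0 < th by rewrite divr_gt0.
have th1 : th <= 1 by rewrite /th; lra.
(* The Archimedean bound gives 2 / th^4 <= m for n = m + 1, and adding 2 also makes m positive. *)
exists (Num.bound (2 / th ^+ 4)).+2 => -[//|m] m_ge E E_faces card_E.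
set n := m.+1 in E E_faces card_E *; rewrite /uniform_pr.
set t := 10%:R ^- 3 * c ^+ 2 * n%:R ^+ 2; set B := [set x in _ | _].
have m_gt0 : (0 < m)%N by lia.
have m0 : 0 < m%:R :> R by rewrite ltr0n.
have n0 : 0 < n%:R :> R by rewrite ltr0n.
have th_m : 2 / m%:R <= th ^+ 4.
  rewrite ler_pdivrMr // mulrC -ler_pdivrMr ?exprn_gt0 //.
  apply: (@le_trans _ _ (Num.bound (2 / th ^+ 4))%:R).
    by apply/ltW/archi_boundP; rewrite divr_ge0 ?exprn_ge0 ?ltW.
  by rewrite ler_nat; lia.
have B_latin : B \subset latin_squares n.
  by apply/subsetP => L; rewrite inE => /andP[].
have B_hits : {in B, forall L, (hits E L)%:R <= t}.
  by move=> L; rewrite inE => /andP[_ /ltW].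
have th01 : 0 < th <= 1 by rewrite th0.
have card_B := card_few_hits_le E_faces m_gt0 B_latin B_hits th01 th_m.
have card_L := @card_latin_squares_ge R m.
have L0 : 0 < #|latin_squares n|%:R :> R by apply: lt_le_trans card_L; exact: expR_gt0.
rewrite ltr_pdivrMr //.
apply: lt_le_trans (ler_wpM2l (expR_ge0 _) card_L).
apply: (le_lt_trans card_B); rewrite -expRD ltr_expR -/n.
have E_ge : c * n%:R ^+ 2 / 2 <= #|E|%:R / (2 * n%:R).
  rewrite ler_pdivlMr ?mulr_gt0 //; apply: le_trans card_E.
  by rewrite le_eqVlt; apply/orP; left; apply/eqP; field.
have nn0 : 0 < n%:R ^+ 2 :> R by rewrite exprn_gt0.
have t_lt : 2 * t < c * n%:R ^+ 2 / 10.
  have : 10%:R ^- 3 * c ^+ 2 <= c / 100.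
    by rewrite -exprVn expr2; nra.
  rewrite /t; move: (_ * c ^+ 2) => x x_le; nra.
rewrite /th; move: (ln n%:R) => l; nra.
Qed.
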